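(* Let $\Pi$ be a profinite group and let $m$ be an infinite cardinal. Then $\Pi$ is a free profinite group of rank $m$ if and only if the following conditions are satisfied: (i) $\Pi$ is projective. (ii) $\Pi$ is quasi-free of rank $m$.
   Context: All homomorphisms of profinite groups are continuous, and generating sets are taken in the topological sense. A subset $S$ of a profinite group $\Pi$ converges to $1$ if every open normal subgroup of $\Pi$ contains all but finitely many elements of $S$. The rank of $\Pi$ is the minimal cardinality of a generating set converging to $1$. $\Pi$ is free if it has a generating set $S$ converging to $1$ such that for every profinite group $\Delta$ and every map $\phi_0:S\to\Delta$ with $\phi_0(S)$ converging to $1$, $\phi_0$ extends to a homomorphism $\Pi\to\Delta$; for every cardinal $m$ there is, up to isomorphism, a unique free profinite group of rank $m$. An embedding problem for $\Pi$ is a pair $\mathcal E=(\alpha:\Pi\to G,\ f:\Gamma\to G)$ of epimorphisms of profinite groups. It is finite if $\Gamma$ is finite, non-trivial if $\ker f\neq1$, and split if $f$ has a section. A weak solution is a homomorphism $\lambda:\Pi\to\Gamma$ with $f\lambda=\alpha$; a proper solution is a surjective weak solution. $\Pi$ is projective if every finite embedding problem for $\Pi$ has a weak solution. For an infinite cardinal $m$, $\Pi$ is quasi-free of rank $m$ if every non-trivial finite split embedding problem for $\Pi$ has exactly $m$ proper solutions. *)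

(* Defs.v *)
From HB Require Import structures.
From mathcomp Require Import all_boot all_order.
From mathcomp Require Import boolp classical_sets functions cardinality.
From mathcomp Require Import topology.

Set Implicit Arguments.
Unset Strict Implicit.
Unset Printing Implicit Defensive.

Local Open Scope classical_set_scope.
Local Open Scope card_scope.
Local Open Scope group_scope.

HB.mixin Record isTopologicalGroup G & Topological G & Group G := {
  mulg_continuous : continuous (fun x : G * G => x.1 * x.2) ;
  invg_continuous : continuous (fun x : G => x^-1)
}.

#[short(type="topologicalGroupType")]
HB.structure Definition TopologicalGroup :=
  {G of Topological G & Group G & isTopologicalGroup G}.

HB.mixin Record TopologicalGroup_isProfinite G & TopologicalGroup G := {
  profinite_compact : compact [set: G] ;
  profinite_hausdorff : hausdorff_space G ;
  profinite_totally_disconnected : totally_disconnected [set: G]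
}.

#[short(type="profiniteGroupType")]
HB.structure Definition ProfiniteGroup :=
  {G of TopologicalGroup G & TopologicalGroup_isProfinite G}.

Definition subgroup (G : groupType) (H : set G) : Prop :=
  [/\ H 1, forall x y, H x -> H y -> H (x * y) & forall x, H x -> H x^-1].

Definition normal_subgroup (G : groupType) (N : set G) : Prop :=
  subgroup N /\ forall x g, N x -> N (x ^ g).

Definition continuous_hom (G H : topologicalGroupType) (f : G -> H) : Prop :=
  monoid_morphism f /\ continuous f.

Definition epimorphism (G H : topologicalGroupType) (f : G -> H) : Prop :=
  continuous_hom f /\ set_surj [set: G] [set: H] f.

Definition hom_ker (G H : groupType) (f : G -> H) : set G := f @^-1` [set 1].

Definition generates (G : topologicalGroupType) (S : set G) : Prop :=
  smallest [set H : set G | subgroup H /\ closed H] S = [set: G].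

Definition converges_to_1 (G : topologicalGroupType) (S : set G) : Prop :=
  forall N : set G, open N -> normal_subgroup N -> finite_set (S `\` N).

(* Convergence to 1 of the family (phi s)_{s in S}, counted with multiplicity:
   requiring only that the set phi @` S converges to 1 would admit all constant
   maps, and no group with an infinite S would be free. *)
Definition map_converges_to_1 (G : Type) (D : topologicalGroupType)
    (S : set G) (phi : G -> D) : Prop :=
  forall N : set D, open N -> normal_subgroup N ->
    finite_set [set s | S s /\ ~ N (phi s)].

(* A map S -> D is given by a function on all of G, of which only the
   restriction to S matters. *)
Definition free_profinite (G : profiniteGroupType) : Prop :=
  exists S : set G,
    [/\ generates S,
        converges_to_1 S &
        forall (D : profiniteGroupType) (phi0 : G -> D),
          map_converges_to_1 S phi0 ->
          exists phi : G -> D,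
            continuous_hom phi /\ (forall s, S s -> phi s = phi0 s)].

(* A cardinal is represented by a type M of that cardinality. *)
Definition has_rank (G : profiniteGroupType) (M : Type) : Prop :=
  (exists S : set G,
     [/\ generates S, converges_to_1 S & S #= [set: M]]) /\
  (forall S : set G,
     generates S -> converges_to_1 S -> [set: M] #<= S).

Definition free_profinite_of_rank (G : profiniteGroupType) (M : Type) : Prop :=
  free_profinite G /\ has_rank G M.

Record embedding_problem (Pi : profiniteGroupType) := EmbeddingProblem {
  ep_quot : profiniteGroupType ;
  ep_group : profiniteGroupType ;
  ep_alpha : Pi -> ep_quot ;
  ep_f : ep_group -> ep_quot ;
  ep_alpha_epi : epimorphism ep_alpha ;
  ep_f_epi : epimorphism ep_f
}.

Section EmbeddingProblems.
Variable Pi : profiniteGroupType.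
Implicit Type E : embedding_problem Pi.

Definition ep_finite E : Prop := finite_set [set: ep_group E].

Definition ep_nontrivial E : Prop := hom_ker (@ep_f _ E) <> [set 1].

Definition ep_split E : Prop :=
  exists s : ep_quot E -> ep_group E,
    continuous_hom s /\ cancel s (@ep_f _ E).

Definition weak_solution E (lam : Pi -> ep_group E) : Prop :=
  continuous_hom lam /\ @ep_f _ E \o lam = @ep_alpha _ E.

Definition proper_solution E (lam : Pi -> ep_group E) : Prop :=
  weak_solution lam /\ set_surj [set: Pi] [set: ep_group E] lam.

Definition projective : Prop :=
  forall E, ep_finite E -> exists lam, @weak_solution E lam.

Definition quasi_free (M : Type) : Prop :=
  forall E, ep_nontrivial E -> ep_finite E -> ep_split E ->
    [set lam | @proper_solution E lam] #= [set: M].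

End EmbeddingProblems.

(* Main.v *)
Require Import Defs.
From HB Require Import structures.
From mathcomp Require Import all_boot all_order.
From mathcomp Require Import fingroup perm morphism quotient.
From mathcomp Require Import gproduct gseries.
From mathcomp Require Import boolp classical_sets functions cardinality.
From mathcomp Require Import wochoice.
From mathcomp Require Import topology.

Set Implicit Arguments.
Unset Strict Implicit.
Unset Printing Implicit Defensive.

Local Open Scope classical_set_scope.
Local Open Scope card_scope.
Local Open Scope group_scope.

(** Being projective and quasi-free of rank M says that Pi has as many proper
    solutions of finite embedding problems as a free group of rank M has, and
    these numbers determine a profinite group up to isomorphism.

    Let Pi be free on S.  A homomorphism to a finite group is a finitely
    supported map on S, so lifting the values on S solves embedding problems
    weakly.  For proper solutions of a problem with kernel K, use |K| elements
    of S to cover K; any further element of S may be sent to a fixed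
    non-trivial element of K, which gives |S| solutions
    ([free_proper_solutions]).  There are at most M homomorphisms, since each
    is coded by a finite sequence over a generating set of size M
    ([embeds_hom]).

    Conversely, projectivity and a fibre product turn an arbitrary finite
    embedding problem into a split one, so that every non-trivial finite
    embedding problem of Pi has at least M proper solutions: Pi is [rich]
    ([rich_of_projective_quasi_free]).  A free group F on M exists, as a closed
    subgroup of a product of finite symmetric groups, and is rich by the first
    half.  Moreover Pi and F have at most M open normal subgroups
    ([embeds_open_normal]), so it remains to see that two such groups A and B
    are isomorphic ([rich_isomorphic]).

    This is a transfinite back-and-forth, carried out without infinite quotient
    groups.  Its stages are closed subgroups R of A * B with surjective
    projections, that is, isomorphisms A / L -> B / L' in the sense of Goursat,
    starting from R = A * B.  By compactness these properties pass to
    intersections of chains ([nested_correspondences]).  A successor step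
    intersects R with one clopen set so that L enters a given open normal
    subgroup of A, and L' one of B ([refine]).  Splitting the step into chief
    factors reduces it to a finite quotient q : A -> gT for which q (L) is
    minimal normal.  What is needed is a lift B -> gT of B -> gT / q (L) that
    is non-trivial on L'.  There are M proper lifts because B is rich, and
    fewer than M of them are trivial on L' because R is cut out by fewer than M
    clopen sets ([refine_minimal], [few_homs_killing_fiber]).  At the end L and
    L' are trivial and R is the graph of an isomorphism. *)

(** * Infinite cardinals *)

Definition embeds (T U : Type) : Prop := exists f : T -> U, injective f.

Lemma sval_inj T (A : set T) : injective (sval : {x | A x} -> T).
Proof. by move=> [x Ax] [y Ay] /= xy; apply: eq_exist. Qed.

Lemma embeds_refl T : embeds T T.
Proof. by exists id. Qed.

Lemma embeds_trans T U V : embeds T U -> embeds U V -> embeds T V.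
Proof. by move=> [f fI] [g gI]; exists (g \o f); apply: inj_comp. Qed.

Lemma embeds_prod T U T' U' :
  embeds T T' -> embeds U U' -> embeds (T * U) (T' * U').
Proof.
move=> [f fI] [g gI]; exists (fun x => (f x.1, g x.2)).
by move=> [x y] [x' y'] /= [/fI-> /gI->].
Qed.

Lemma embeds_seq T U : embeds T U -> embeds (seq T) (seq U).
Proof. by move=> [f fI]; exists (map f); apply: inj_map. Qed.

Lemma embeds_sig T (A B : set T) : A `<=` B -> embeds {x | A x} {x | B x}.
Proof.
move=> AB; exists (fun x => exist B (sval x) (AB _ (svalP x))).
by move=> [x Ax] [y Ay] [/= xy]; apply: eq_exist.
Qed.

Lemma card_leE T U (A : set T) (B : set U) :
  A #<= B <-> embeds {x | A x} {y | B y}.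
Proof.
split=> [/card_leP/injfunPex[f _ fI]|[f fI]].
  pose g (x : {x | A x}) : A := exist _ (sval x) (mem_set (svalP x)).
  exists (fun x => exist B (val (f (g x))) (set_valP (f (g x)))).
  move=> [x Ax] [y Ay] [/val_inj /(fI _ _ (mem_set I) (mem_set I))] [] xy.
  exact: eq_exist.
apply/card_leP/injfunPex.
pose h (x : A) : {x | A x} := exist _ (val x) (set_valP x).
exists (fun x : A => exist (fun y => y \in B) (sval (f (h x)))
   (mem_set (svalP (f (h x))))) => //.
move=> x y _ _ [] /sval_inj /fI[].
exact: val_inj.
Qed.

Lemma card_le_setT T U : [set: T] #<= [set: U] <-> embeds T U.
Proof.
rewrite card_leE; split=> -[f fI].
  exists (fun x => sval (f (exist _ x I))) => x y.
  by move=> /sval_inj /fI[].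
exists (fun x => exist _ (f (sval x)) I) => -[x ?] [y ?] [/fI xy].
exact: eq_exist.
Qed.

Lemma card_leTl T U (B : set U) : [set: T] #<= B <-> embeds T {y | B y}.
Proof.
rewrite card_leE; split; apply: embeds_trans.
  by exists (fun x => exist _ x I) => x y [].
by exists sval; apply: sval_inj.
Qed.

Lemma card_leTr T U (A : set T) : A #<= [set: U] <-> embeds {x | A x} U.
Proof.
rewrite card_leE; split=> H; apply: (embeds_trans H).
  by exists sval; apply: sval_inj.
by exists (fun x => exist _ x I) => x y [].
Qed.

Lemma infinite_embeds T : infinite_set [set: T] <-> embeds nat T.
Proof. by rewrite infiniteP card_le_setT. Qed.

(** Zorn's lemma on the partial injections, seen as graphs: a maximal one is
    defined everywhere or is onto. *)
Lemma embeds_total T U : embeds T U \/ embeds U T.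
Proof.
pose pinj (G : set (T * U)) := forall p q, G p -> G q -> p.1 = q.1 <-> p.2 = q.2.
have [F Fsub Ftot|G [Gp Gmax]] := @Zorn_bigcup _ pinj.
  move=> p q [G FG Gp] [H FH Hq].
  by case: (Ftot _ _ FG FH) => sGH; [apply: (Fsub _ FH) => //|
    apply: (Fsub _ FG) => //]; exact: sGH.
have [fst_total|/existsNP[x Nx]] := pselect (forall x, exists y, G (x, y)).
  left; have [f fP] := choice fst_total; exists f => x x' ff.
  by have /= [_ ->] := Gp _ _ (fP x) (fP x').
have [snd_total|/existsNP[y Ny]] := pselect (forall y, exists x, G (x, y)).
  right; have [f fP] := choice snd_total; exists f => y y' ff.
  by have /= [/(_ ff)] := Gp _ _ (fP y) (fP y').
exfalso; apply: (Gmax (G `|` [set (x, y)])).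
  split; first by move=> p; left.
  by move=> /(_ (x, y) (or_intror erefl)) Gxy; apply: Nx; exists y.
move=> [a b] [a' b'] [Gab|[-> ->]] [Gab'|[-> ->]] //=.
- exact: (Gp _ _ Gab Gab').
- split=> E; subst; first by case: Nx; exists b.
  by case: Ny; exists a.
- split=> E; subst; first by case: Nx; exists b'.
  by case: Ny; exists a'.
Qed.

(** Zorn's lemma on the subsets A of M that carry a pairing function
    A * A -> A.  If the complement of a maximal A embeds into A then so does M;
    otherwise A has a disjoint copy gA, and the pairing extends to the union
    because the three new blocks of (A + gA) * (A + gA) fit into gA. *)
Theorem embeds_square M : embeds nat M -> embeds (M * M) M.
Proof.
move=> [e eI].
pose good (p : set M * (M -> M -> M)) :=
  [/\ forall n, p.1 (e n), forall x y, p.1 x -> p.1 y -> p.1 (p.2 x y) &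
      forall x y x' y', p.1 x -> p.1 y -> p.1 x' -> p.1 y' ->
        p.2 x y = p.2 x' y' -> x = x' /\ y = y'].
pose le (p q : {p | good p}) := `[< (sval p).1 `<=` (sval q).1 /\
  forall x y, (sval p).1 x -> (sval p).1 y ->
    (sval p).2 x y = (sval q).2 x y >].
have e_good : exists p, good p.
  (* the range of e, with the pairing of nat, starts the construction *)
  pose A := [set x | exists n, x = e n].
  pose dec x : nat := if pselect (A x) is left Ax then sval (cid Ax) else 0%N.
  have decK n : dec (e n) = n.
    rewrite /dec; case: pselect => [Ax|[]]; last by exists n.
    by case: cid => k /= /eI.
  exists (A, fun x y => e (pickle (dec x, dec y))); split => /=.
  - by move=> n; exists n.
  - by move=> x y _ _; eexists.
  - move=> _ _ _ _ [n ->] [k ->] [n' ->] [k' ->] /eI.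
    by rewrite !decK => /(pcan_inj pickleK) [-> ->].
have [p0 p0_good] := e_good.
have [||F Ftot|[[A f] Agood] pmax] :=
    @ZL_preorder _ (exist _ p0 p0_good) le.
- by move=> p; apply/asboolP; split.
- move=> q p r /asboolP[pq Epq] /asboolP[qr Eqr]; apply/asboolP; split.
    exact: subset_trans qr.
  by move=> x y px py; rewrite Epq // Eqr //; apply: pq.
- have [F0|/contrapT[q0 Fq0]] := pselect (~ exists q, F q).
    by exists (exist _ p0 p0_good) => q Fq; case: F0; exists q.
  pose B := [set x | exists2 q, F q & (sval q).1 x].
  pose D x y := exists2 q, F q & (sval q).1 x /\ (sval q).1 y.
  have BD x y : B x -> B y -> D x y.
    move=> [q Fq qx] [r Fr ry].
    by case: (Ftot _ _ Fq Fr) => /asboolP[sqr _];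
      [exists r|exists q] => //; split=> //; apply: sqr.
  pose g x y := if pselect (D x y) is left H
    then (sval (s2val (cid2 H) : {p | good p})).2 x y else x.
  have gE q x y : F q -> (sval q).1 x -> (sval q).1 y ->
      g x y = (sval q).2 x y.
    move=> Fq qx qy; rewrite /g; case: pselect => [H|[]]; last by exists q.
    case: cid2 => r /= Fr [rx ry].
    by case: (Ftot _ _ Fq Fr) => /asboolP[_ Eqr]; rewrite Eqr.
  have Bg : good (B, g).
    split=> /=.
    - by move=> n; exists q0 => //; have [+ _ _] := svalP q0; apply.
    - move=> x y Bx By; have [q Fq [qx qy]] := BD x y Bx By.
      rewrite (gE q) //; exists q => //.
      by have [_ + _] := svalP q; apply.
    - move=> x y x' y' Bx By Bx' By'.
      have [q Fq [qx qy]] := BD x y Bx By.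
      have [r Fr [rx ry]] := BD x' y' Bx' By'.
      rewrite (gE q) // (gE r) //.
      case: (Ftot _ _ Fq Fr) => /asboolP[sqr E]; rewrite E //.
        by have [_ _ rI] := svalP r; apply: rI; rewrite //; apply: sqr.
      by have [_ _ qI] := svalP q; apply: qI; rewrite //; apply: sqr.
  exists (exist _ _ Bg) => q Fq; apply/asboolP; split=> /=.
    by move=> x qx; exists q.
  by move=> x y qx qy; rewrite (gE q).
have [/= Ae Af fI] := Agood.
case: (embeds_total {x | ~ A x} {x | A x}) => [[h hI]|[g gI]].
  pose h' x := if pselect (A x) is right nAx
    then sval (h (exist _ x nAx)) else x.
  pose k x := if pselect (A x) then f (e 0%N) x else f (e 1%N) (h' x).
  have Ah' x : A (h' x).
    by rewrite /h'; case: pselect => // nAx; apply: (svalP (h _)).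
  have Ak x : A (k x) by rewrite /k; case: pselect => Ax; apply: Af.
  have h'I x y : ~ A x -> ~ A y -> h' x = h' y -> x = y.
    rewrite /h'; case: pselect => // nAx _; case: pselect => // nAy _.
    by move=> /sval_inj /hI[].
  have kI : injective k.
    move=> x y; rewrite /k; case: pselect => Ax; case: pselect => Ay.
    - by move=> /fI[].
    - by move=> /fI[] // /eI.
    - by move=> /fI[] // /eI.
    - by move=> /fI[] // _ /h'I-/(_ Ax Ay).
  exists (fun p => f (k p.1) (k p.2)) => -[x y] [x' y'] /= /fI[] //.
  by move=> /kI-> /kI->.
exfalso.
pose B := [set x | exists y, x = sval (g y)].
have nAB x : B x -> ~ A x by move=> [y ->]; apply: (svalP (g y)).
pose bar x := if pselect (B x) is left Bx then sval (projT1 (cid Bx)) else x.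
have barA x : A x -> bar x = x.
  by rewrite /bar; case: pselect => // Bx Ax; case: (nAB x Bx).
have AbarB x : B x -> A (bar x).
  by rewrite /bar; case: pselect => // Bx _; case: cid => -[a Aa].
have Abar x : (A `|` B) x -> A (bar x).
  by move=> [Ax|/AbarB//]; rewrite barA.
have barBI x y : B x -> B y -> bar x = bar y -> x = y.
  rewrite /bar; case: pselect => // Bx _; case: pselect => // By _.
  case: cid => a /= ->; case: cid => b /= ->.
  by move=> /sval_inj ->.
pose g' x := if pselect (A x) is left Ax then sval (g (exist _ x Ax)) else x.
have Bg' x : A x -> B (g' x).
  by rewrite /g'; case: pselect => // Ax _; eexists.
have g'I x y : A x -> A y -> g' x = g' y -> x = y.
  rewrite /g'; case: pselect => // Ax _; case: pselect => // Ay _.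
  by move=> /sval_inj /gI[].
(* tag x y tells which of the three new blocks contains (x, y) *)
pose tag x y := if pselect (A x) then 0%N else if pselect (A y) then 1%N else 2.
pose f2 x y := if pselect (A x /\ A y) then f x y
  else g' (f (e (tag x y)) (f (bar x) (bar y))).
have barI x y : (A `|` B) x -> (A `|` B) y -> bar x = bar y ->
    (A x <-> A y) -> x = y.
  move=> [Ax|Bx] [Ay|By]; first by rewrite !barA.
  - by move=> _ /iffLR/(_ Ax) Ay; case: (nAB y By).
  - by move=> _ /iffRL/(_ Ay) Ax; case: (nAB x Bx).
  - by move=> E _; apply: barBI.
have AF t x y : (A `|` B) x -> (A `|` B) y -> A (f (e t) (f (bar x) (bar y))).
  by move=> Dx Dy; apply: (Af _ _ (Ae t)); apply: Af; apply: Abar.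
have good2 : good (A `|` B, f2).
  split=> /=.
  - by move=> n; left.
  - move=> x y Dx Dy; rewrite /f2; case: pselect => [[Ax Ay]|nAxy].
      by left; apply: Af.
    by right; apply: Bg'; apply: AF.
  - move=> x y x' y' Dx Dy Dx' Dy'; rewrite /f2.
    case: pselect => [[Ax Ay]|nA]; case: pselect => [[Ax' Ay']|nA'] /=.
    + exact: fI.
    + move=> E; case: (nAB _ (Bg' _ (AF (tag x' y') _ _ Dx' Dy'))).
      by rewrite -E; apply: Af.
    + move=> E; case: (nAB _ (Bg' _ (AF (tag x y) _ _ Dx Dy))).
      by rewrite E; apply: Af.
    + move=> /g'I-/(_ (AF _ _ _ Dx Dy) (AF _ _ _ Dx' Dy')) /fI[] //;
        do ?by apply: Af; apply: Abar.
      move=> /eI tE /fI[]; do ?exact: Abar.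
      move=> bx by_.
      have [ixx iyy] : (A x <-> A x') /\ (A y <-> A y').
        move: tE; rewrite /tag; do 4 case: pselect => ?; move=> // _; tauto.
      by split; apply: barI.
have AB_ext : le (exist _ _ Agood) (exist _ _ good2).
  apply/asboolP; split=> [x|x y Ax Ay] /=; first by left.
  by rewrite /f2; case: pselect => // -[].
have /asboolP[/= sBA _] := pmax _ AB_ext.
have Bge : B (g' (e 0%N)) by apply: Bg'.
by apply: (nAB _ Bge); apply: sBA; right.
Qed.

Lemma embeds_nat_prod M : embeds nat M -> embeds (nat * M) M.
Proof.
move=> Minf; apply: embeds_trans (embeds_square Minf).
exact: embeds_prod Minf (embeds_refl M).
Qed.

(** A sequence is coded by its length and the iterated pairing of its entries. *)
Lemma embeds_seq_self M : embeds nat M -> embeds (seq M) M.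
Proof.
move=> Minf; have [e _] := Minf; have [p pI] := embeds_square Minf.
apply: embeds_trans (embeds_nat_prod Minf).
exists (fun s => (size s, foldr (fun x y => p (x, y)) (e 0%N) s)).
elim=> [|x s IHs] [|y t] //= [sz /pI[-> E]]; congr (_ :: _).
by apply: IHs; rewrite sz E.
Qed.

Lemma finite_embeds_ord T : finite_set [set: T] <-> exists n, embeds T 'I_n.
Proof.
rewrite finite_set_leP; split=> -[n Tn]; exists n.
  by apply/card_le_setT; rewrite -(card_le_eqr card_II).
by rewrite (card_le_eqr card_II); apply/card_le_setT.
Qed.

Lemma finType_not_infinite (F : finType) : ~ embeds nat F.
Proof.
move=> /infinite_embeds; apply; exact: finite_finset.
Qed.

Lemma infinite_setE T (S : set T) : infinite_set S <-> embeds nat {x | S x}.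
Proof. by rewrite infiniteP card_leTl. Qed.

(** The finite set A is absorbed by the copies of the complement in
    nat * (S \ A). *)
Lemma embeds_setD_finite T (S A : set T) :
  embeds nat {x | S x} -> finite_set A -> embeds {x | S x} {x | (S `\` A) x}.
Proof.
move=> /infinite_setE Sinf finA.
have Binf : embeds nat {x | (S `\` A) x}.
  apply/infinite_setE => finB; apply: Sinf.
  have : finite_set ((S `\` A) `|` A) by rewrite finite_setU.
  by apply: sub_finite_set => x Sx; have [Ax|nAx] := pselect (A x); [right|left].
apply: embeds_trans (embeds_nat_prod Binf).
have [a aI] : embeds {x | A x} nat.
  move/finite_set_countable: finA => /card_leTr; exact.
have [b _] := Binf.
pose c x := if pselect (A x) is left Ax then (a (exist _ x Ax)).+1 else 0%N.
pose d (x : {x | S x}) : {x | (S `\` A) x} :=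
  if pselect (A (sval x)) is right nAx then exist _ (sval x) (conj (svalP x) nAx)
  else b 0%N.
exists (fun x => (c (sval x), d x)) => -[x Sx] [y Sy]; rewrite /c /d /=.
case: pselect => Ax; case: pselect => Ay //.
  by case=> /aI [xy]; apply: eq_exist.
by case=> xy; apply: eq_exist.
Qed.

Lemma embeds_option M J : embeds nat M -> embeds M (option J) -> embeds M J.
Proof.
move=> Minf MJ.
have [finJ|/infinite_embeds Jinf] := pselect (finite_set [set: J]).
  have [n [c cI]] := (finite_embeds_ord J).1 finJ.
  case: (@finType_not_infinite (option 'I_n)).
  apply: embeds_trans Minf (embeds_trans MJ _).
  by exists (omap c) => -[x|] [y|] //= [/cI->].
apply: embeds_trans MJ (embeds_trans _ (embeds_nat_prod Jinf)).
have [e _] := Jinf.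
exists (fun o => if o is Some j then (0%N, j) else (1%N, e 0%N)).
by move=> [x|] [y|] //= [->].
Qed.

Lemma card_inj_range (T U : Type) (f : T -> U) : injective f -> range f #= [set: T].
Proof. by move=> fI; apply: inj_card_eq => x y _ _; apply: fI. Qed.

(** W consists of the elements of a well-order of M whose initial segment is
    smaller than M; order-theoretically it is the initial ordinal of the
    cardinality of M.  It indexes a transfinite recursion with M steps in which
    every stage has fewer than M predecessors. *)
Theorem initial_well_order (M : Type) :
  exists (W : Type) (lt : W -> W -> Prop),
    [/\ well_founded lt, (forall x y z, lt x y -> lt y z -> lt x z),
        (forall x y, [\/ lt x y, x = y | lt y x]), embeds M W &
        forall w, ~ embeds M {v | lt v w}].
Proof.
elim/Peq: M => M; have [R Rwo] := well_ordering_principle M.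
have min_ex (A : set M) : A !=set0 ->
    exists2 z, A z & forall x, A x -> R z x.
  move=> [x Ax]; have [|z [[zA minz] _]] := Rwo (mem A).
    by exists x; rewrite inE.
  by exists z => [|y Ay]; [rewrite inE in zA | apply: minz; rewrite inE].
have Rwo' : wo_chain R (predT : {pred M}) by move=> A _; apply: Rwo.
have Rtot x y : R x y || R y x by apply: (wo_chainW Rwo').
have Ranti x y : R x y -> R y x -> x = y.
  by move=> xy yx; apply: (wo_chain_antisymmetric Rwo') => //; rewrite xy yx.
have Rtr x y z : R x y -> R y z -> R x z.
  move=> xy yz; have [|t At mint] := min_ex [set t | [\/ t = x, t = y | t = z]].
    by exists x; constructor 1.
  have [tx ty tz] : [/\ R t x, R t y & R t z].
    by split; apply: mint; [constructor 1|constructor 2|constructor 3].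
  case: At => E; subst t => //.
    by rewrite -(Ranti _ _ tx xy).
  by rewrite (Ranti _ _ yz ty) in xy.
pose lt x y := R x y /\ x <> y.
have ltwf : well_founded lt.
  move=> x; apply: contrapT => nAx.
  have [z nAz minz] := min_ex [set x | ~ Acc lt x] (ex_intro _ x nAx).
  apply: nAz; constructor => y [yz ney]; apply: contrapT => /minz zy.
  exact/ney/Ranti.
(* P is an initial segment: all of M, or the elements below the least one
   whose initial segment is as large as M *)
pose P : set M := [set j | ~ embeds M {k | lt k j}].
exists {j | P j}, (fun x y => lt (sval x) (sval y)); split.
- move=> [x Px]; elim: (ltwf x) Px => {}x _ IH Px.
  by constructor => -[y Py] /= yx; apply: IH.
- move=> [x ?] [y ?] [z ?] /= [xy nxy] [yz nyz]; split; first exact: Rtr yz.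
  by move=> xz; subst z; apply/nxy/Ranti.
- move=> [x Px] [y Py] /=; have [xy|nxy] := pselect (x = y).
    by constructor 2; apply: eq_exist.
  by case/orP: (Rtot x y) => h; [constructor 1|constructor 3]; split=> // /esym.
- have [Pall|] := pselect (forall j, P j).
    by exists (fun j => exist _ j (Pall j)) => x y [].
  move=> /existsNP Pex; have [i nPi mini] := min_ex (~` P) Pex.
  have /contrapT Mi := nPi; apply: embeds_trans Mi _; apply: embeds_sig.
  move=> j [ji nji]; apply: contrapT => /mini ij; exact/nji/Ranti.
- move=> [w Pw] Mw; apply: (Pw); apply: embeds_trans Mw _.
  have vw (v : {v : {j | P j} | lt (sval v) w}) : lt (sval (sval v)) w := svalP v.
  by exists (fun v => exist (lt^~ w) _ (vw v)) => x y [] /sval_inj/sval_inj.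
Qed.

(** * Compactness *)

(** The witness is a cluster point of the filter generated by the sets C i. *)
Lemma compact_directed (T : topologicalType) (I : Type) (C : I -> set T) (i0 : I) :
  compact [set: T] -> (forall i, closed (C i)) ->
  (forall i j, exists k, C k `<=` C i `&` C j) ->
  (forall i, C i !=set0) -> exists x, forall i, C i x.
Proof.
move=> cT cC dirC neC; pose F := filter_from [set: I] C.
have FF : ProperFilter F.
  apply: filter_from_proper => [|i _]; last exact: neC.
  apply: filter_from_filter => [|i j _ _]; first by exists i0.
  by have [k] := dirC i j; exists k.
have [|x [_ Fx]] := cT F FF; first by exists i0.
exists x => i; apply: cC; rewrite closureEnbhs => A B CA Bx.
by apply: Fx Bx; exists i.
Qed.

Lemma all_set_nil T I (C : I -> set T) :
  [set x | all (fun i => `[< C i x >]) [::]] = [set: T].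
Proof. by apply/seteqP. Qed.

Lemma all_set_cons T I (C : I -> set T) i s :
  [set x | all (fun i => `[< C i x >]) (i :: s)] =
  C i `&` [set x | all (fun i => `[< C i x >]) s].
Proof.
apply/seteqP; split=> x /=; first by case/andP => /asboolP.
by case=> Cix sx; apply/andP; split=> //; apply/asboolP.
Qed.

(** Otherwise the finite intersections of the C i, cut with the complement of
    U, would be a directed family of nonempty closed sets. *)
Lemma compact_finite_inter (T : topologicalType) (I : Type) (C : I -> set T)
    (U : set T) :
  compact [set: T] -> (forall i, closed (C i)) -> open U ->
  (forall x, (forall i, C i x) -> U x) ->
  exists s : seq I, forall x, all (fun i => `[< C i x >]) s -> U x.
Proof.
move=> cT cC oU CU; apply: contrapT => /forallNP nfin.
pose K (s : seq I) := [set x | all (fun i => `[< C i x >]) s] `&` ~` U.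
have [s|s t|s|x Kx] := @compact_directed T _ K [::] cT.
- apply: closedI; last exact: open_closedC.
  by elim: s => [|i s IHs]; rewrite ?all_set_nil ?all_set_cons;
    [exact: closedT|exact: closedI].
- by exists (s ++ t) => x [] /=; rewrite all_cat => /andP[]; do !split.
- have /existsNP[x /not_implyP[sx nUx]] := nfin s; by exists x.
- have [_ nUx] := Kx [::]; apply/nUx/CU => i.
  by have [/= /andP[/asboolP]] := Kx [:: i].
Qed.

Lemma continuous_image_closed (A B : topologicalType) (f : A -> B) (C : set A) :
  compact [set: A] -> hausdorff_space B -> continuous f -> closed C ->
  closed (f @` C).
Proof.
move=> cA hB fc cC; apply: compact_closed => //.
apply: continuous_compact; first exact: continuous_subspaceT.
exact: subclosed_compact cA _.
Qed.

(** The preimage of C is the first projection of the part of the graph that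
    lies over C. *)
Lemma closed_graph_continuous (A B : topologicalType) (f : A -> B) :
  compact [set: A] -> compact [set: B] -> hausdorff_space A ->
  closed [set p : A * B | f p.1 = p.2] -> continuous f.
Proof.
move=> cA cB hA cG; apply/continuous_closedP => C cC.
have -> : f @^-1` C = fst @` ([set p | f p.1 = p.2] `&` snd @^-1` C).
  apply/seteqP; split=> [x Cx|_ [[x y] [/= <- Cx] <-] //].
  by exists (x, f x).
apply: continuous_image_closed => //.
- by rewrite -setXTT; apply: compact_setX.
- by move=> p; apply: cvg_fst.
- apply: closedI => //; move: C cC; apply/continuous_closedP => p; exact: cvg_snd.
Qed.

(** A component of a compact Hausdorff space is the intersection Q of the
    clopen sets around it: if Q were the union of two disjoint closed pieces,
    then these would have disjoint open neighbourhoods covering a clopen set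
    around Q, and the part of that clopen set in one of the two neighbourhoods
    would be clopen. *)
Lemma clopen_separation (T : topologicalType) (x y : T) :
  compact [set: T] -> hausdorff_space T -> totally_disconnected [set: T] ->
  x <> y -> exists U : set T, [/\ clopen U, U x & ~ U y].
Proof.
move=> cT hT tT nxy; apply: contrapT => nsep.
pose Q := [set z | forall U : set T, clopen U -> U x -> U z].
have Qy : Q y by move=> U cU Ux; apply: contrapT => nUy; apply: nsep; exists U.
have Qx : Q x by [].
suff Qconn : connected Q.
  have : connected_component [set: T] x y by exists Q => //; split.
  by rewrite tT // => /esym.
have cQ : closed Q.
  have -> : Q = \bigcap_(U in [set U : set T | clopen U /\ U x]) U.
    by apply/seteqP; split=> z Qz U; [case; apply: Qz|move=> cU Ux; apply: Qz].
  by apply: closed_bigI => U [[]].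
apply: contrapT => /connectedPn[E [nE QE [sE1 sE2]]].
have cE b : closed (E b).
  move=> z zE; have : Q z.
    by apply: cQ; apply: closureS zE => w; rewrite QE; case: b; [right|left].
  rewrite QE => -[]; case: b zE => // zE Ez.
    have : (E false `&` closure (E true)) z by split.
    by rewrite sE2.
  have : (closure (E false) `&` E true) z by split.
  by rewrite sE1.
have dE z : E false z -> E true z -> False.
  move=> z0 z1; have : (E false `&` closure (E true)) z.
    by split=> //; apply: subset_closure.
  by rewrite sE2.
have : exists U V : set T, [/\ open U, open V, E false `<=` U, E true `<=` V &
    forall z, U z -> V z -> False].
  have nE1 : set_nbhs (E false) (~` E true).
    apply/set_nbhsP; exists (~` E true).
    by split=> //; apply: closed_openC; apply: cE.
  have [B /set_nbhsP[C [oC EC CB]] BE] := compact_normal hT cT (cE false) nE1.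
  exists C, (~` closure B); split; [by []| | by []| | ].
  - exact/closed_openC/closed_closure.
  - by move=> z z1 /BE.
  - by move=> z /CB /subset_closure.
move=> [U [V [oU oV EU EV dUV]]].
have [|||s sUV] := @compact_finite_inter T {C : set T | clopen C /\ C x}
    (fun C => sval C) (U `|` V) cT.
- by move=> [C [[]]].
- exact: openU.
- move=> z Cz; have : Q z by move=> C cC Cx; exact: (Cz (exist _ C (conj cC Cx))).
  by rewrite QE => -[/EU|/EV]; [left|right].
pose D := [set z | all (fun C : {C : set T | clopen C /\ C x} => `[< sval C z >]) s].
have [cD Dx] : clopen D /\ D x.
  rewrite /D; elim: (s) => [|C t [cD Dx]].
    by rewrite all_set_nil; split=> //; exact: clopenT.
  have [cC Cx] := svalP C.
  by rewrite (all_set_cons (fun C : {C : set T | clopen C /\ C x} => sval C));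
    split=> //; exact: clopenI.
have cDU W W' : open W -> open W' -> (forall z, W z -> W' z -> False) ->
    (forall z, D z -> W z \/ W' z) -> clopen (D `&` W).
  move=> oW oW' dW DW; split; first by apply: openI => //; case: cD.
  have -> : D `&` W = D `&` ~` W'.
    apply/seteqP; split=> z [Dz]; first by move=> Wz; split=> // /(dW z Wz).
    by case: (DW z Dz) => // Wz _.
  by apply: closedI; [case: cD|exact: open_closedC].
have [z0 E0] := nE false; have [z1 E1] := nE true.
have : Q x by []. rewrite QE => -[/EU Ux|/EV Vx].
  have : Q z1 by rewrite QE; right.
  move=> /(_ _ (cDU U V oU oV dUV sUV) (conj Dx Ux)) [_ /dUV]; apply.
  exact: EV.
have : Q z0 by rewrite QE; left.
have dVU z : V z -> U z -> False by move=> /[swap]; apply: dUV.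
have sVU z : D z -> V z \/ U z by move=> /sUV[]; [right|left].
move=> /(_ _ (cDU V U oV oU dVU sVU) (conj Dx Vx)) [_ /dVU]; apply.
exact: EU.
Qed.

(** * Topological groups *)

Section TopologicalGroups.
Variable G : topologicalGroupType.

Lemma continuous_mulg (T : topologicalType) (f g : T -> G) :
  continuous f -> continuous g -> continuous (fun x => f x * g x).
Proof.
move=> cf cg x.
apply: (@continuous_comp _ _ _ (fun x => (f x, g x)) (fun p => p.1 * p.2)).
  by apply: cvg_pair; [exact: cf|exact: cg].
exact: mulg_continuous.
Qed.

Lemma continuous_invg (T : topologicalType) (f : T -> G) :
  continuous f -> continuous (fun x => (f x)^-1).
Proof.
move=> cf x; apply: (@continuous_comp _ _ _ f (fun y => y^-1)).
  exact: cf.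
exact: invg_continuous.
Qed.

Lemma continuous_lmul (a : G) : continuous (fun x : G => a * x).
Proof. by apply: continuous_mulg => x; [exact: cvg_cst|exact: cvg_id]. Qed.

Lemma nbhs_lmul (a : G) (A : set G) :
  nbhs (1 : G) A -> \forall x \near a, A (a^-1 * x).
Proof. by move=> nA; apply: continuous_lmul; rewrite mulVg. Qed.

Lemma open_subgroup (H : set G) : subgroup H -> nbhs (1 : G) H -> open H.
Proof.
move=> [H1 HM HV] nH; rewrite openE => a Ha; rewrite /interior.
have := nbhs_lmul a nH; apply: filterS => x Hx.
by rewrite -[x](mulVKg a); apply: HM.
Qed.

End TopologicalGroups.

Section Homomorphisms.
Variables G H : groupType.
Variable f : G -> H.
Hypothesis fH : monoid_morphism f.

Lemma hom1 : f 1 = 1. Proof. by case: fH. Qed.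
Lemma homM x y : f (x * y) = f x * f y. Proof. by case: fH => _ ->. Qed.
Lemma homV x : f x^-1 = (f x)^-1.
Proof. by apply: (@mulIg _ (f x)); rewrite -homM !mulVg hom1. Qed.
Lemma homJ x y : f (x ^ y) = f x ^ f y.
Proof. by rewrite !conjgE !homM homV. Qed.

Lemma hom_ker_normal : normal_subgroup (hom_ker f).
Proof.
split; first split; rewrite /hom_ker /=.
- exact: hom1.
- by move=> x y fx fy; rewrite /= homM fx fy mulg1.
- by move=> x fx; rewrite /= homV fx invg1.
- by move=> x g fx; rewrite /= homJ fx conj1g.
Qed.

Lemma hom_eq x y : f x = f y <-> f (x^-1 * y) = 1.
Proof.
rewrite homM homV; split=> [->|]; first by rewrite mulVg.
by move=> E; rewrite -[f x]mulg1 -E mulVKg.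
Qed.

End Homomorphisms.

Lemma normal_subgroupI (G : groupType) (N N' : set G) :
  normal_subgroup N -> normal_subgroup N' -> normal_subgroup (N `&` N').
Proof.
move=> [[N1 NM NV] NJ] [[N1' NM' NV'] NJ']; split; first split=> //.
- by move=> a b [? ?] [? ?]; split; [apply: NM|apply: NM'].
- by move=> a [? ?]; split; [apply: NV|apply: NV'].
- by move=> a g [? ?]; split; [apply: NJ|apply: NJ'].
Qed.

Lemma subgroup_preim (G H : groupType) (f : G -> H) (A : set H) :
  monoid_morphism f -> subgroup A -> subgroup (f @^-1` A).
Proof.
move=> fH [A1 AM AV]; split=> [|x y|x] /=.
- by rewrite hom1.
- by rewrite homM //; apply: AM.
- by rewrite homV //; apply: AV.
Qed.

Lemma normal_preim (G H : groupType) (f : G -> H) (A : set H) :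
  monoid_morphism f -> normal_subgroup A -> normal_subgroup (f @^-1` A).
Proof.
move=> fH [sA AJ]; split; first exact: subgroup_preim.
by move=> x g /= Ax; rewrite homJ //; apply: AJ.
Qed.

Lemma hom_comp (G H K : groupType) (f : G -> H) (g : H -> K) :
  monoid_morphism f -> monoid_morphism g -> monoid_morphism (g \o f).
Proof.
by move=> fH gH; split=> [|x y] /=; rewrite ?hom1 // !homM.
Qed.

Lemma continuous_hom_comp (G H K : topologicalGroupType)
    (f : G -> H) (g : H -> K) :
  continuous_hom f -> continuous_hom g -> continuous_hom (g \o f).
Proof.
move=> [fH fc] [gH gc]; split; first exact: hom_comp.
by move=> x; apply: continuous_comp; [exact: fc|exact: gc].
Qed.

Lemma smallest_closed_subgroup (G : topologicalGroupType) (S : set G) :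
  let A := smallest [set H : set G | subgroup H /\ closed H] S in
  subgroup A /\ closed A.
Proof.
split; last by apply: closed_bigI => H [[_ ?] _].
split=> [H [[[]]] //|x y Ax Ay H HH|x Ax H HH]; have [[[_ HM HV] _] _] := HH.
- by apply: HM; [apply: Ax|apply: Ay].
- by apply: HV; apply: Ax.
Qed.

(** * Open normal subgroups of profinite groups *)

Section Profinite.
Variable G : profiniteGroupType.

(** For a clopen U around 1, the elements n such that U contains both or none
    of a n b and a b, for all a and b, form a normal subgroup inside U.  The
    condition holds for n near 1 uniformly in (a, b) because G * G is compact
    and U is clopen. *)
Lemma open_normal_in_clopen (U : set G) : clopen U -> U 1 ->
  exists N : set G, [/\ open N, normal_subgroup N & N `<=` U].
Proof.
move=> [oU cU] U1.
pose N := [set n : G | forall a b, U (a * n * b) <-> U (a * b)].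
have Nsub : subgroup N.
  split=> [a b|x y Nx Ny a b|x Nx a b].
  - by rewrite mulg1.
  - by rewrite mulgA Ny Nx.
  - by rewrite -(Nx (a * x^-1) b) mulgVK.
have NU : N `<=` U by move=> x /(_ 1 1); rewrite mul1g mulg1 => ->; rewrite mulg1.
have Nnormal : normal_subgroup N.
  split=> // x g Nx a b; rewrite conjgE.
  have -> : a * (g^-1 * (x * g)) * b = (a * g^-1) * x * (g * b) by rewrite !mulgA.
  by rewrite Nx mulgA mulgVK.
exists N; split=> //; apply: open_subgroup => //.
have /compact_near_coveringP cGG : compact [set: G * G].
  by rewrite -setXTT; apply: compact_setX; exact: profinite_compact.
have c3 : continuous (fun z : (G * G) * G => z.1.1 * z.2 * z.1.2).
  by do !apply: continuous_mulg; move=> z;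
    do ?[exact: cvg_snd|apply: cvg_comp cvg_fst _; exact: cvg_fst
        |apply: cvg_comp cvg_fst _; exact: cvg_snd].
have c2 : continuous (fun z : (G * G) * G => z.1.1 * z.1.2).
  by do !apply: continuous_mulg; move=> z;
    do ?[exact: cvg_snd|apply: cvg_comp cvg_fst _; exact: cvg_fst
        |apply: cvg_comp cvg_fst _; exact: cvg_snd].
pose P (n : G) (p : G * G) := U (p.1 * n * p.2) <-> U (p.1 * p.2).
have near_P (p : G * G) : \forall p' \near p & n \near (1 : G), P n p'.
  have H : nbhs (p, (1 : G)) [set z | P z.2 z.1].
    have both W : open W -> W (p.1 * p.2) -> nbhs (p, (1 : G))
        [set z | W (z.1.1 * z.2 * z.1.2) /\ W (z.1.1 * z.1.2)].
      move=> oW Wp; apply: filterI.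
        by apply: (c3 (p, 1) W); apply: open_nbhs_nbhs; split=> //=; rewrite mulg1.
      by apply: (c2 (p, 1) W); apply: open_nbhs_nbhs.
    have [Up|nUp] := pselect (U (p.1 * p.2)).
      by apply: filterS (both U oU Up) => z [].
    by apply: filterS (both (~` U) (closed_openC cU) nUp) => z [].
  exact: H.
have H := cGG _ _ P (nbhs_filter (1 : G)) (fun p _ => near_P p).
apply: filterS H => n H a b; exact: (H (a, b) I).
Qed.

Lemma open_normal_separation (x : G) : x <> 1 ->
  exists N : set G, [/\ open N, normal_subgroup N & ~ N x].
Proof.
move=> /nesym nx.
have [U [cU U1 nUx]] := clopen_separation (@profinite_compact G)
  (@profinite_hausdorff G) (@profinite_totally_disconnected G) nx.
have [N [oN nN NU]] := open_normal_in_clopen cU U1.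
by exists N; split=> // /NU.
Qed.

Lemma open_cosets_finite (N : set G) : subgroup N -> open N ->
  exists s : seq G, forall x, exists2 y, y \in s & N (y^-1 * x).
Proof.
move=> sN oN; have [|||s sP] := @compact_finite_inter G G
  (fun y => [set x | ~ N (y^-1 * x)]) set0 (@profinite_compact G).
- move=> y; rewrite -[X in closed X]setCK; apply: open_closedC.
  rewrite [X in open X](_ : _ = (fun x => y^-1 * x) @^-1` N).
    by move/continuousP: (@continuous_lmul G y^-1); apply.
  by apply/seteqP; split=> x /=; rewrite notK.
- exact: open0.
- by move=> x /(_ x); rewrite /= mulVg; case: sN.
exists s => x; apply: contrapT => nx; apply: (sP x).
by apply/allP => y ys; apply/asboolP => Nyx; apply: nx; exists y.
Qed.

(** The quotient by an open normal subgroup N, realised through its right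
    multiplication action on coset representatives s_0, ..., s_(n-1): the
    permutation of x sends i to the index of the coset of s_i x.  Realising
    finite quotients inside the symmetric groups 'S_n leaves only countably
    many of them. *)
Theorem finite_quotient (N : set G) : open N -> normal_subgroup N ->
  exists (n : nat) (H : {group 'S_n}) (q : G -> subg_of H),
    [/\ monoid_morphism q, (forall h, exists x, q x = h) &
        forall x, q x = 1 <-> N x].
Proof.
move=> oN [sN NJ]; have [N1 NM NV] := sN.
have [s sP] := open_cosets_finite sN oN.
pose n := size s.
pose r0 x := find (fun y => `[< N (y^-1 * x) >]) s.
have r0_lt x : (r0 x < n)%N.
  rewrite -has_find; have [y ys Ny] := sP x.
  by apply/hasP; exists y => //; apply/asboolP.
pose r x : 'I_n := Ordinal (r0_lt x).
pose c (i : 'I_n) := nth 1 s i.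
have cr x : N ((c (r x))^-1 * x).
  have := nth_find 1 (_ : has (fun y => `[< N (y^-1 * x) >]) s).
  by rewrite has_find => /(_ (r0_lt x)) /asboolP.
have rE x y : N (x^-1 * y) -> r x = r y.
  move=> Nxy; apply: val_inj => /=; apply: eq_find => z.
  apply/asboolP/asboolP => [Nx|Ny]; first by rewrite -[y](mulVKg x) mulgA; apply: NM.
  rewrite -[x](mulVKg y) mulgA; apply: NM => //.
  by rewrite -[_ * _]invgK invgM invgK; apply: NV.
have rI x y : r x = r y -> N (x^-1 * y).
  move=> rxy; have Nx := cr x; have Ny := cr y; rewrite rxy in Nx.
  rewrite -[y](mulVKg (c (r y))) mulgA; apply: NM => //.
  by rewrite -[_ * _]invgK invgM invgK; apply: NV.
have NJ' x z : N z -> N (x * z * x^-1).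
  by move=> /(NJ _ x^-1); rewrite conjgE invgK mulgA.
have rcr x y : r (c (r x) * y) = r (x * y).
  apply: (rE); rewrite invgM -mulgA (mulgA _^-1 x y).
  by have := NJ _ y (cr x); rewrite conjgE.
have rcr1 x : r (c (r x)) = r x by have := rcr x 1; rewrite !mulg1.
pose im i := `[< exists x, r x = i >].
(* indices outside the image of r are left fixed *)
pose sg x (i : 'I_n) := if im i then r (c i * x) else i.
have imr x : im (r x) by apply/asboolP; exists x.
have sgr x y : sg x (r y) = r (y * x) by rewrite /sg imr rcr.
have sgI x : injective (sg x).
  move=> i j; rewrite /sg.
  case: ifP => [/asboolP[y <-]|ni]; case: ifP => [/asboolP[z <-]|nj] //.
  - rewrite !rcr => /rI; rewrite invgM -mulgA (mulgA _^-1 z x) => Nzx.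
    apply: (rE); have := NJ' x _ Nzx.
    by rewrite mulVKg mulgK.
  - by move=> E; rewrite -E imr in nj.
  - by move=> E; rewrite E imr in ni.
pose rho x : 'S_n := perm (@sgI x).
have rhoE x y : rho (x * y) = (rho x * rho y)%g.
  apply/permP => i; rewrite permM !permE /=.
  have [/asboolP[z <-]|nim] := boolP (im i); first by rewrite !sgr mulgA.
  by rewrite /sg (negbTE nim) /= (negbTE nim).
have rho1 : rho 1 = 1%g.
  by apply: (@mulgI _ (rho 1)); rewrite -rhoE !mulg1.
pose A : {set 'S_n} := finset (fun s => `[< exists x, rho x = s >]).
have AP s' : reflect (exists x, rho x = s') (s' \in A).
  by rewrite inE; apply: asboolP.
have gA : group_set A.
  apply/group_setP; split; first by apply/AP; exists 1.
  by move=> _ _ /AP[x <-] /AP[y <-]; apply/AP; exists (x * y).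
pose H := Group gA.
have rhoH x : rho x \in H by apply/AP; exists x.
exists n, H, (fun x => subg H (rho x)); split.
- split; first by rewrite rho1; apply: val_inj; rewrite /= subgK // group1.
  by move=> x y; rewrite rhoE; apply: val_inj; rewrite /= !subgK // ?groupM.
- move=> h; have /AP[x xh] := subgP h; exists x.
  by apply: val_inj; rewrite /= subgK // xh.
- move=> x; split=> [/(congr1 val)|Nx].
    rewrite /= subgK // => /permP/(_ (r 1)); rewrite permE perm1 sgr mul1g.
    by move=> /esym/rI; rewrite invg1 mul1g.
  apply: val_inj; rewrite /= subgK //; apply/permP => i; rewrite permE perm1.
  rewrite /sg; case: ifP => // /asboolP[y <-]; rewrite rcr; apply/esym/rE.
  by rewrite mulKg.
Qed.

End Profinite.

(** * Finite groups as discrete profinite groups *)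

Definition disc (gT : finGroupType) : Type := discrete_topology gT.

Section Disc.
Variable gT : finGroupType.
HB.instance Definition _ := DiscreteTopology.on (disc gT).
HB.instance Definition _ := Group.copy (disc gT) gT.

Lemma disc_continuous (T : topologicalType) (f : disc gT -> T) : continuous f.
Proof.
move=> x A nA; apply: (@filterS _ (nbhs x) _ [set x] (f @^-1` A)).
  by move=> y ->; exact: (nbhs_singleton nA).
exact: (@discrete_set1 (disc gT)).
Qed.

Lemma disc_mul_continuous : continuous (fun x : disc gT * disc gT => x.1 * x.2).
Proof.
move=> [a b] A nA; exists ([set a], [set b]).
  by split; apply: discrete_set1.
by move=> [c d] [/= -> ->]; have := nbhs_singleton nA.
Qed.

HB.instance Definition _ := isTopologicalGroup.Build (disc gT)
  disc_mul_continuous (@disc_continuous _ _).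

Lemma disc_finite : finite_set [set: disc gT].
Proof. exact: (@finite_finset gT). Qed.

HB.instance Definition _ := TopologicalGroup_isProfinite.Build (disc gT)
  (finite_compact disc_finite) discrete_hausdorff
  (zero_dimension_totally_disconnected discrete_zero_dimension).

End Disc.

Lemma finite_open (D : profiniteGroupType) (A : set D) :
  finite_set [set: D] -> open A.
Proof.
move=> finD; rewrite -[A]setCK; apply: closed_openC.
apply: compact_closed; first exact: profinite_hausdorff.
by apply: finite_compact; apply: sub_finite_set finD.
Qed.

Lemma open_ker_continuous (G H : topologicalGroupType) (f : G -> H) :
  monoid_morphism f -> open (hom_ker f) -> continuous f.
Proof.
move=> fH oK x A nA; have : nbhs (1 : G) (hom_ker f).
  by apply: open_nbhs_nbhs; split=> //; apply: hom1.
move=> /(nbhs_lmul x) near_x; apply: (@filterS _ (nbhs x) _ _ (f @^-1` A) _ near_x).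
move=> y; rewrite /hom_ker /= => /(hom_eq fH) <-.
exact: (nbhs_singleton nA).
Qed.

Lemma finite_ker_open (G : topologicalGroupType) (D : profiniteGroupType)
    (f : G -> D) : continuous f -> finite_set [set: D] -> open (hom_ker f).
Proof.
by move=> /continuousP + finD; apply; apply: finite_open.
Qed.

Lemma finite_quotient_disc (G : profiniteGroupType) (N : set G) :
  open N -> normal_subgroup N ->
  exists (n : nat) (H : {group 'S_n}) (q : G -> disc (subg_of H)),
    epimorphism q /\ hom_ker q = N.
Proof.
move=> oN nN; have [n [H [q [qH qS qN]]]] := finite_quotient oN nN.
have kerq : hom_ker (q : G -> disc (subg_of H)) = N.
  by apply/seteqP; split=> x /qN.
exists n, H, q; split=> //; split.
  by split=> //; apply: open_ker_continuous => //; rewrite kerq.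
by move=> h _; have [x] := qS h; exists x.
Qed.

(** * Counting homomorphisms to finite groups *)

Lemma closed_set1 (D : profiniteGroupType) (x : D) : closed [set x].
Proof.
apply: compact_closed; first exact: profinite_hausdorff.
exact: compact_set1.
Qed.

Lemma hom_eq_on_generators (G : topologicalGroupType) (D : profiniteGroupType)
    (S : set G) (f g : G -> D) :
  generates S -> continuous_hom f -> continuous_hom g ->
  (forall s, S s -> f s = g s) -> f = g.
Proof.
move=> genS [fH fc] [gH gc] fg; apply/funext => x.
pose H := [set x | f x = g x].
suff : [set: G] `<=` H by apply.
rewrite -genS; apply: smallest_sub => //; split.
  split; rewrite /H /=; first by rewrite !hom1.
  - by move=> a b fga fgb; rewrite !homM // fga fgb.
  - by move=> a fga; rewrite !homV // fga.
have -> : H = (fun x => (f x)^-1 * g x) @^-1` [set 1].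
  apply/seteqP; split=> z; rewrite /H /=; first by move->; rewrite mulVg.
  by move=> E; rewrite -[f z]mulg1 -E mulVKg.
have /continuous_closedP : continuous (fun x => (f x)^-1 * g x).
  by apply: continuous_mulg => //; apply: continuous_invg.
by apply; apply: closed_set1.
Qed.

Lemma hom_support_finite (G : topologicalGroupType) (D : profiniteGroupType)
    (S : set G) (f : G -> D) :
  converges_to_1 S -> continuous_hom f -> finite_set [set: D] ->
  finite_set (S `\` hom_ker f).
Proof.
by move=> cS [fH fc] finD; apply: cS; [apply: finite_ker_open|exact: hom_ker_normal].
Qed.

(** A homomorphism to a finite group D is determined by its finitely many
    non-trivial values on a generating set converging to 1. *)
Lemma embeds_hom_seq (G D : profiniteGroupType) (S : set G) :
  generates S -> converges_to_1 S -> finite_set [set: D] ->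
  embeds {f : G -> D | continuous_hom f} (seq ({x | S x} * D)).
Proof.
move=> genS cS finD.
pose hom_code (f : G -> D) (l : seq ({x | S x} * D)) :=
  (forall x, f (sval x) <> 1 -> has (fun p => `[< p = (x, f (sval x)) >]) l) /\
  all (fun p => `[< f (sval p.1) = p.2 >]) l.
have fP (f : {f : G -> D | continuous_hom f}) : exists l, hom_code (sval f) l.
  have /finite_seqP[s sE] := hom_support_finite cS (svalP f) finD.
  suff [l [lP lall]] : exists l : seq ({x | S x} * D),
      (forall x, sval x \in s -> has (fun p => `[< p = (x, sval f (sval x)) >]) l) /\
      all (fun p => `[< sval f (sval p.1) = p.2 >]) l.
    exists l; split=> // x fx; apply: lP.
    have : (S `\` hom_ker (sval f)) (sval x) by split=> //; apply: svalP x.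
    by rewrite sE.
  elim: s {sE} => [|y s [l [lP lall]]]; first by exists [::].
  have [Sy|nSy] := pselect (S y); last first.
    exists l; split=> // x; rewrite inE => /orP[/eqP xy|/lP//].
    by case: nSy; rewrite -xy; apply: svalP x.
  exists ((exist _ y Sy, sval f y) :: l); split=> [x|] /=; last first.
    by rewrite lall andbT; apply/asboolP.
  rewrite inE => /orP[/eqP xy|/lP->]; last by rewrite orbT.
  by apply/orP; left; apply/asboolP; rewrite xy; congr (_, _); apply: sval_inj.
have [code codeP] := choice fP; exists code => f g fg.
have half h k : code h = code k -> forall x : {x | S x}, sval h (sval x) <> 1 ->
    sval h (sval x) = sval k (sval x).
  move=> hk x hx; have [hin _] := codeP h; have [_] := codeP k.
  rewrite -hk; have := hin x hx; elim: (code h) => //= p l IH.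
  by move=> /orP[/asboolP-> /andP[/asboolP]|/IH H /andP[_ /H]].
apply: sval_inj; apply: (hom_eq_on_generators genS (svalP f) (svalP g)).
move=> x Sx; apply: contrapT => nfg.
have [f1|nf1] := pselect (sval f x = 1); last first.
  exact: nfg (half f g fg (exist _ x Sx) nf1).
apply/nfg/esym/(half g f (esym fg) (exist _ x Sx)) => /= g1.
by rewrite f1 g1 in nfg.
Qed.

Lemma embeds_hom (M : Type) (G D : profiniteGroupType) (S : set G) :
  embeds nat M -> generates S -> converges_to_1 S -> embeds {x | S x} M ->
  finite_set [set: D] -> embeds {f : G -> D | continuous_hom f} M.
Proof.
move=> Minf genS cS SM finD; apply: embeds_trans (embeds_hom_seq genS cS finD) _.
apply: embeds_trans (embeds_seq_self Minf); apply: embeds_seq.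
apply: embeds_trans (embeds_square Minf); apply: embeds_prod SM _.
have [n Dn] := (finite_embeds_ord D).1 finD; apply: embeds_trans Dn _.
by apply: embeds_trans Minf; exists val; apply: val_inj.
Qed.

(** A finite S would leave only finitely many homomorphisms, and for infinite S
    the finite sequences that code them are no more numerous than S. *)
Lemma embeds_generators (M : Type) (G D : profiniteGroupType) (S : set G) :
  embeds nat M -> generates S -> converges_to_1 S -> finite_set [set: D] ->
  embeds M {f : G -> D | continuous_hom f} -> embeds M {x | S x}.
Proof.
move=> Minf genS cS finD Mhom.
have [n [d dI]] := (finite_embeds_ord D).1 finD.
have [finS|/infinite_embeds Sinf] := pselect (finite_set [set: {x | S x}]).
  have [k [c cI]] := (finite_embeds_ord _).1 finS.
  case: (@finType_not_infinite {set 'I_k * 'I_n}).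
  apply: embeds_trans Minf (embeds_trans Mhom _).
  exists (fun f => finset (fun p : 'I_k * 'I_n =>
    `[< exists2 x, c x = p.1 & d (sval f (sval x)) = p.2 >])) => f g /setP fg.
  apply: sval_inj; apply: (hom_eq_on_generators genS (svalP f) (svalP g)) => x Sx.
  pose x' : {x | S x} := exist _ x Sx.
  have := fg (c x', d (sval f x)); rewrite !inE.
  have -> : `[< exists2 x0, c x0 = c x' & d (sval f (sval x0)) = d (sval f x) >].
    by apply/asboolP; exists x'.
  by move=> /esym/asboolP[y /cI-> /dI].
apply: embeds_trans Mhom (embeds_trans (embeds_hom_seq genS cS finD) _).
apply: embeds_trans (embeds_seq_self Sinf); apply: embeds_seq.
apply: embeds_trans (embeds_square Sinf); apply: embeds_prod (embeds_refl _) _.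
apply: embeds_trans Sinf.
by apply: embeds_trans (ex_intro _ d dI) _; exists val; apply: val_inj.
Qed.

(** Every finite quotient is isomorphic to a subgroup of some 'S_n, so countably
    many targets suffice, and an open normal subgroup is coded by a target and
    an epimorphism with that kernel. *)
Lemma embeds_open_normal (M : Type) (G : profiniteGroupType) :
  embeds nat M ->
  (forall gT : finGroupType, embeds {q : G -> disc gT | epimorphism q} M) ->
  embeds {N : set G | open N /\ normal_subgroup N} M.
Proof.
move=> Minf epiM; pose U := {n : nat & {group 'S_n}}.
pose e (u : U) := projT1 (cid (epiM (subg_of (tagged u)))).
have eI u : injective (e u) := projT2 (cid (epiM (subg_of (tagged u)))).
have NP (N : {N : set G | open N /\ normal_subgroup N}) :
    exists z : {u : U & {q : G -> disc (subg_of (tagged u)) | epimorphism q}},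
    hom_ker (sval (tagged z)) = sval N.
  case: N => N0 [oN nN].
  have [n [H [q [qE kq]]]] := finite_quotient_disc oN nN.
  by exists (existT (fun u : U => {q : G -> disc (subg_of (tagged u)) | epimorphism q})
    (existT _ n H : U) (exist _ q qE)).
have [code codeP] := choice NP.
apply: embeds_trans (embeds_nat_prod Minf).
exists (fun N => (pickle (tag (code N)), e _ (tagged (code N)))) => N N' [].
move=> /(pcan_inj pickleK) E1 E2; apply: sval_inj; rewrite -!codeP.
move: (code N) (code N') E1 E2 => [u q] [u' q'] /= E; subst u'.
by move=> /eI->.
Qed.

(** * Embedding problems for a group with a free basis *)

Section FreeBasis.
Variables (G : profiniteGroupType) (S : set G).
Hypothesis genS : generates S.
Hypothesis cS : converges_to_1 S.
Hypothesis univS : forall (D : profiniteGroupType) (phi0 : G -> D),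
  map_converges_to_1 S phi0 ->
  exists phi : G -> D, continuous_hom phi /\ (forall s, S s -> phi s = phi0 s).

Lemma free_extension (D : profiniteGroupType) (phi0 : G -> D) (A : set G) :
  finite_set A -> (forall s, S s -> ~ A s -> phi0 s = 1) ->
  exists phi : G -> D, continuous_hom phi /\ (forall s, S s -> phi s = phi0 s).
Proof.
move=> finA phi0A; apply: univS => N oN [[N1 _ _] _].
apply: sub_finite_set finA => s [Ss nN]; apply: contrapT => /(phi0A s Ss) E.
by apply: nN; rewrite E.
Qed.

Variable E : embedding_problem G.
Hypothesis finE : ep_finite E.

Let Gam := ep_group E.
Let f : Gam -> ep_quot E := @ep_f _ E.
Let alpha : G -> ep_quot E := @ep_alpha _ E.

Let fH : monoid_morphism f. Proof. by case: (ep_f_epi E) => -[]. Qed.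
Let alphaH : continuous_hom alpha. Proof. by case: (ep_alpha_epi E). Qed.

Let finQ : finite_set [set: ep_quot E].
Proof.
have [_ fS] := ep_f_epi E.
apply: sub_finite_set (finite_image f finE) => q _.
by have [x _ <-] := fS q I; exists x.
Qed.

(** A set-theoretic section of f, normalised at 1 so that almost all elements
    of a basis are lifted to 1. *)
Lemma ep_lift : exists g : ep_quot E -> Gam, (forall q, f (g q) = q) /\ g 1 = 1.
Proof.
have [_ fS] := ep_f_epi E.
have /choice[g gP] : forall q, exists x, f x = q.
  by move=> q; have [x _ <-] := fS q I; exists x.
exists (fun q => if pselect (q = 1) then 1 else g q); split=> [q|].
  by case: pselect => [q1|nq1] /=; [rewrite q1; apply: hom1|].
by case: pselect.
Qed.

Lemma weak_solution_on_basis (lam : G -> Gam) :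
  continuous_hom lam -> (forall s, S s -> f (lam s) = alpha s) ->
  weak_solution lam.
Proof.
move=> lamH lamS; split=> //.
have fc : continuous_hom f by case: (ep_f_epi E).
exact: (hom_eq_on_generators genS (continuous_hom_comp lamH fc) alphaH lamS).
Qed.

Lemma free_weak_solution : exists lam : G -> Gam, weak_solution lam.
Proof.
have [g [fg g1]] := ep_lift.
have [|s Ss nA|lam [lamH lamS]] :=
    @free_extension Gam (g \o alpha) (S `\` hom_ker alpha).
- exact: hom_support_finite.
- have -> : (g \o alpha) s = g (alpha s) by [].
  suff -> : alpha s = 1 by [].
  by apply: contrapT => ns; apply: nA; split.
exists lam; apply: weak_solution_on_basis => // s Ss.
by rewrite lamS //= fg.
Qed.

(** Outside the finitely many basis elements with non-trivial image in the
    quotient, values may be prescribed freely in K = ker f.  Using |K| of these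
    elements to cover K makes the solution surjective; every other one, s1,
    gives its own solution, the one that is non-trivial on s1 but trivial on
    the rest. *)
Lemma free_proper_solutions (M : Type) :
  embeds nat M -> embeds M {x | S x} -> ep_nontrivial E ->
  embeds M {lam : G -> Gam | proper_solution lam}.
Proof.
move=> Minf MS ntE; have Sinf := embeds_trans Minf MS.
have [g [fg g1]] := ep_lift.
pose S0 := S `\` hom_ker alpha.
have finS0 : finite_set S0 by exact: hom_support_finite.
have alpha1 s : S s -> ~ S0 s -> alpha s = 1.
  by move=> Ss nS0; apply: contrapT => ns; apply: nS0; split.
have [j jI] : embeds Gam {x | (S `\` S0) x}.
  have [n Gn] := (finite_embeds_ord _).1 finE.
  apply: embeds_trans Gn (embeds_trans _ (embeds_setD_finite Sinf finS0)).
  by apply: embeds_trans Sinf; exists val; apply: val_inj.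
(* the basis elements reserved for covering ker f *)
pose T := (fun x => sval (j x)) @` [set: Gam].
have finT : finite_set T by exact: finite_image finE.
have [k0 fk0 nk0] : exists2 k0, f k0 = 1 & k0 <> 1.
  apply: contrapT => nk; apply: ntE; apply/seteqP; split=> x; rewrite /hom_ker /=.
    by move=> fx; apply: contrapT => nx; apply: nk; exists x.
  by move=> ->; apply: hom1.
pose base s := if pselect (exists2 x, f x = 1 & sval (j x) = s) is left H
  then s2val (cid2 H) else g (alpha s).
have baseT x : f x = 1 -> base (sval (j x)) = x.
  move=> fx; rewrite /base; case: pselect => [H|[]]; last by exists x.
  by case: cid2 => y /= _ /sval_inj/jI.
have fbase s : S s -> f (base s) = alpha s.
  move=> Ss; rewrite /base; case: pselect => [H|nH] /=; last exact: fg.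
  case: cid2 => y /= fy ys; rewrite fy alpha1 //.
  by rewrite -ys; case: (svalP (j y)).
have base1 s : S s -> ~ (S0 `|` T) s -> base s = 1.
  move=> Ss nST; rewrite /base; case: pselect => [H|nH] /=.
    by case: cid2 => y /= fy ys; case: nST; right; exists y.
  by rewrite alpha1 // => S0s; apply: nST; left.
have finST : finite_set (S0 `|` T) by rewrite finite_setU.
apply: embeds_trans MS (embeds_trans (embeds_setD_finite Sinf finST) _).
pose phi s1 s := if pselect (s = s1) then k0 else base s.
have solP (s1 : {x | (S `\` (S0 `|` T)) x}) : exists lam : G -> Gam,
    proper_solution lam /\ forall s, S s -> lam s = phi (sval s1) s.
  case: s1 => s1 [/= Ss1 nST1].
  have [|s Ss nA|lam [lamH lamS]] :=
      @free_extension Gam (phi s1) (S0 `|` T `|` [set s1]).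
  - by rewrite finite_setU; split=> //; exact: finite_set1.
  - rewrite /phi; case: pselect => [E1|nE1] /=; first by case: nA; right.
    by apply: base1 => // ?; apply: nA; left.
  have wlam : weak_solution lam.
    apply: weak_solution_on_basis => // s Ss; rewrite lamS // /phi.
    case: pselect => [E1|nE1] /=; last exact: fbase.
    by rewrite E1 fk0 alpha1 // => S01; apply: nST1; left.
  exists lam; split=> //; split=> // x _.
  have [[lam_hom _] flam] := wlam.
  have [_ aS] := ep_alpha_epi E.
  have [p _ pE] := aS (f x) I.
  have flp : f (lam p) = f x by rewrite -pE -flam.
  pose k := (lam p)^-1 * x.
  have fk : f k = 1 by apply/hom_eq.
  have lamk : lam (sval (j k)) = k.
    have [Sj _] := svalP (j k); rewrite lamS // /phi.
    case: pselect => [E1|nE1] /=; last exact: baseT.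
    by case: nST1; right; exists k.
  by exists (p * sval (j k)) => //; rewrite (homM lam_hom) lamk /k mulVKg.
have [sol sol_P] := choice solP.
exists (fun s1 => exist _ (sol s1) (sol_P s1).1) => s1 s2 [] E12.
apply: sval_inj; apply: contrapT => n12.
have [_ sol1] := sol_P s1; have [_ sol2] := sol_P s2.
have [S1 nST1] := svalP s1.
have := sol1 _ S1; rewrite E12 sol2 // /phi.
case: pselect => // ns12; case: pselect => // ns11 /=.
by rewrite base1 // => /esym.
Qed.

End FreeBasis.

(** * Groups with many solutions of finite embedding problems *)

(** The lower bound on the number of proper solutions, for problems that need
    not split.  The groups are finGroupTypes so that the subgroups and quotients
    of finite group theory can serve as embedding problems. *)
Definition rich (G : profiniteGroupType) (M : Type) : Prop :=
  forall (gT hT : finGroupType) (f : gT -> hT) (alpha : G -> disc hT),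
    monoid_morphism f -> (forall h, exists g, f g = h) ->
    (exists2 g, f g = 1 & g <> 1) -> epimorphism alpha ->
    embeds M {lam : G -> disc gT | epimorphism lam /\ forall x, f (lam x) = alpha x}.

Lemma disc_epimorphism (gT hT : finGroupType) (f : gT -> hT) :
  monoid_morphism f -> (forall h, exists g, f g = h) ->
  epimorphism (f : disc gT -> disc hT).
Proof.
move=> fH fS; split; first by split=> //; exact: disc_continuous.
by move=> h _; have [g] := fS h; exists g.
Qed.

Lemma rich_of_proper_solutions (G : profiniteGroupType) (M : Type) :
  (forall E : embedding_problem G, ep_finite E -> ep_nontrivial E ->
    embeds M {lam : G -> ep_group E | proper_solution lam}) -> rich G M.
Proof.
move=> sols gT hT f alpha fH fS [g fg ng] aE.
pose E := EmbeddingProblem aE (disc_epimorphism fH fS).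
have ntE : ep_nontrivial E.
  move=> /seteqP[/(_ g fg) g1 _]; exact: ng.
apply: embeds_trans (sols E (@disc_finite gT) ntE) _.
have P (lam : {lam : G -> ep_group E | proper_solution lam}) :
    epimorphism (sval lam : G -> disc gT) /\
    forall x, f (sval lam x) = alpha x.
  have [[lamH flam] lamS] := svalP lam; split=> // x.
  by rewrite -[RHS](congr1 (fun h => h x) flam).
exists (fun lam => exist _ (sval lam) (P lam)) => l1 l2 [].
exact: sval_inj.
Qed.

Section QuasiFree.
Variables (G : profiniteGroupType) (M : Type).
Hypothesis Minf : embeds nat M.
Hypothesis projG : projective G.
Hypothesis qfG : quasi_free G M.

(** A weak solution lam with image L turns the problem G -> hT <- gT into
    the split problem G -> L <- gT x_hT L given by the fibre product, with the
    diagonal as section; its solutions have lam as second component, and their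
    first components solve the original problem. *)
Lemma rich_of_projective_quasi_free : rich G M.
Proof.
move=> gT hT f alpha fH fS [g fg ng] aE.
pose E := EmbeddingProblem aE (disc_epimorphism fH fS).
have [lam [[lamH lamc] flam']] := projG (@disc_finite gT : ep_finite E).
have flam x : f (lam x) = alpha x.
  by rewrite -[RHS](congr1 (fun h => h x) flam').
have [LG LP] : exists LG : {group gT},
    forall s : gT, s \in LG <-> exists x, lam x = s.
  pose L := finset (fun s : gT => `[< exists x, lam x = s >]).
  have LP s : reflect (exists x, lam x = s) (s \in L).
    by rewrite inE; apply: asboolP.
  have gL : group_set L.
    apply/group_setP; split; first by apply/LP; exists 1; apply: hom1.
    by move=> _ _ /LP[x <-] /LP[y <-]; apply/LP; exists (x * y); apply: homM.
  by exists (Group gL) => s; split=> /LP.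
pose P := finset (fun p : gT * gT => (p.2 \in LG) && (f p.1 == f p.2)).
have gP : group_set P.
  apply/group_setP; split; first by rewrite inE /= group1 eqxx.
  move=> [x y] [x' y']; rewrite !inE /= => /andP[Ly /eqP fxy] /andP[Ly' /eqP fxy'].
  have Lyy : y * y' \in LG by apply: groupM.
  by apply/andP; split=> //; rewrite !homM // fxy fxy'.
pose PG := Group gP.
pose lamL (x : G) : disc (subg_of LG) := subg LG (lam x).
have lamL_in x : lam x \in LG by apply/LP; exists x.
have lamLE x : sgval (lamL x) = lam x by rewrite /lamL subgK.
have lamLH : monoid_morphism lamL.
  split; first by apply: val_inj; rewrite /= lamLE hom1.
  by move=> x y; apply: val_inj; rewrite /= !lamLE homM.
have lamL_epi : epimorphism lamL.
  split; last first.
    move=> l _; have /LP[x xl] := subgP l; exists x => //.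
    by apply: val_inj; rewrite /= lamLE.
  split=> //; apply: open_ker_continuous => //.
  have -> : hom_ker lamL = hom_ker lam.
    apply/seteqP; split=> x; rewrite /hom_ker /= => H.
      by rewrite -lamLE H.
    by apply: val_inj; rewrite /= lamLE H.
  exact: (finite_ker_open lamc (@disc_finite gT)).
have p2L (p : subg_of PG) : (sgval p).2 \in LG.
  by have := subgP p; rewrite inE => /andP[].
pose pr (p : subg_of PG) : subg_of LG := subg LG (sgval p).2.
have prE p : sgval (pr p) = (sgval p).2 by rewrite /pr subgK.
have prH : monoid_morphism pr.
  split; first by apply: val_inj; rewrite /= prE.
  by move=> x y; apply: val_inj; rewrite /= !prE.
have dP (l : subg_of LG) : (sgval l, sgval l) \in PG.
  by rewrite inE /= (subgP l) eqxx.
pose dg (l : subg_of LG) : subg_of PG := subg PG (sgval l, sgval l).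
have dgE l : sgval (dg l) = (sgval l, sgval l) by rewrite /dg subgK.
have dgK : cancel dg pr by move=> l; apply: val_inj; rewrite /= prE dgE.
have dgH : monoid_morphism dg.
  split; first by apply: val_inj; rewrite /= dgE.
  by move=> x y; apply: val_inj; rewrite /= !dgE.
have prS l : exists p, pr p = l by exists (dg l).
pose E' := EmbeddingProblem lamL_epi (disc_epimorphism prH prS).
have splE' : ep_split E'.
  by exists dg; split=> //; split=> //; exact: disc_continuous.
have gP1 : (g, 1) \in PG by rewrite inE /= group1 fg hom1 // eqxx.
have ntE' : ep_nontrivial E'.
  have g_ker : hom_ker (@ep_f _ E') (subg PG (g, 1)).
    by apply: val_inj; rewrite /= prE subgK.
  move=> kE; move: g_ker; rewrite kE => /(congr1 sgval).
  by rewrite subgK // => -[g1]; case: ng.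
have := qfG ntE' (@disc_finite (subg_of PG)) splE'.
rewrite card_eq_le => /andP[_ /card_leTl Msol].
apply: embeds_trans Msol _.
pose fst_sol (mu : G -> ep_group E') (x : G) : disc gT := (sgval (mu x)).1.
have mu2 (mu : G -> ep_group E') : proper_solution mu ->
    forall x, (sgval (mu x)).2 = lam x.
  move=> [[_ muE] _] x; rewrite -prE -lamLE; congr sgval.
  exact: (congr1 (fun h => h x) muE).
have fst_solP (mu : {mu : G -> ep_group E' | proper_solution mu}) :
    epimorphism (fst_sol (sval mu)) /\ forall x, f (fst_sol (sval mu) x) = alpha x.
  have muP := svalP mu; have [[[muH muc] muE] muS] := muP.
  have fmu x : f (fst_sol (sval mu) x) = alpha x.
    have := subgP (sval mu x : subg_of PG); rewrite inE => /andP[_ /eqP].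
    by rewrite (mu2 _ muP) flam.
  split=> //; split.
    have -> : fst_sol (sval mu) =
      (fun p : disc (subg_of PG) => (sgval p).1 : disc gT) \o sval mu by [].
    by apply: continuous_hom_comp => //; split=> //; exact: disc_continuous.
  move=> y _; have [_ aS] := aE; have [x _ xy] := aS (f y) I.
  have yP : (y, lam x) \in PG by rewrite inE /= lamL_in flam xy eqxx.
  have [z _ zE] := muS (subg PG (y, lam x)) I.
  by exists z => //; rewrite /fst_sol zE subgK.
exists (fun mu => exist _ (fst_sol (sval mu)) (fst_solP mu)) => mu nu [] E12.
apply: sval_inj; apply/funext => x; apply: val_inj => /=.
have := congr1 (fun h => h x) E12; rewrite /fst_sol.
have := mu2 _ (svalP mu) x; rewrite -(mu2 _ (svalP nu) x).
by case: (sgval (sval mu x)) (sgval (sval nu x)) => [a b] [c d] /= -> ->.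
Qed.

(** Epimorphisms onto gT solve the split problem with trivial quotient. *)
Lemma quasi_free_card_epi (gT : finGroupType) :
  (exists g : gT, g <> 1) ->
  [set q : G -> disc gT | epimorphism q] #= [set: M].
Proof.
move=> [g ng]; pose tT := subg_of (1%G : {group gT}).
have all1 (t : tT) : t = 1.
  by apply: val_inj; have /set1P := subgP t.
have const1 (H K : topologicalGroupType) : continuous_hom (fun _ : H => 1 : K).
  by split; [split=> // x y; rewrite mulg1|move=> x; apply: cvg_cst].
have aE : epimorphism (fun _ : G => 1 : disc tT).
  by split=> // t _; exists 1 => //; rewrite [t]all1.
have fE : epimorphism (fun _ : disc gT => 1 : disc tT).
  by split=> // t _; exists 1 => //; rewrite [t]all1.
pose E := EmbeddingProblem aE fE.
have ntE : ep_nontrivial E by move=> /seteqP[/(_ g erefl)].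
have splE : ep_split E.
  by exists (fun _ => 1); split=> // t; rewrite [t]all1.
have := qfG ntE (@disc_finite gT) splE; congr (_ #= _).
by apply/seteqP; split=> q [] => [[qH _] qS|qH qS]; split.
Qed.

Lemma quasi_free_embeds_epi (gT : finGroupType) :
  embeds {q : G -> disc gT | epimorphism q} M.
Proof.
have [ntg|ntg] := pselect (exists g : gT, g <> 1).
  apply/card_leTr.
  by have := quasi_free_card_epi ntg; rewrite card_eq_le => /andP[].
have [m _] := Minf; exists (fun _ => m 0%N) => q q' _; apply: sval_inj.
apply/funext => x.
have all1 (h : gT) : h = 1 by apply: contrapT => nh; apply: ntg; exists h.
by rewrite (all1 (sval q x)) (all1 (sval q' x)).
Qed.

End QuasiFree.

(** * Products and closed subgroups of profinite groups *)

Definition dprod (I : choiceType) (K : I -> profiniteGroupType) : Type :=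
  forall i, K i.

Section Product.
Variables (I : choiceType) (K : I -> profiniteGroupType).
Local Notation P := (dprod K).

HB.instance Definition _ := Topological.copy P (prod_topology K).

Lemma dprod_proj_continuous i : continuous (fun x : P => x i).
Proof. exact: (@proj_continuous I K i). Qed.

Lemma dprod_continuous (T : topologicalType) (f : T -> P) :
  (forall i, continuous (fun t => f t i)) -> continuous f.
Proof.
move=> fc t; apply/cvg_sup => i U [_ [[B oB <-] Bft BU]].
apply: (@filterS _ (nbhs t) _ (f @^-1` ((fun x : P => x i) @^-1` B))).
  by move=> u /BU.
by apply: (fc i t B); apply: open_nbhs_nbhs.
Qed.

Definition dprod_one : P := fun i => 1.
Definition dprod_mul (x y : P) : P := fun i => x i * y i.
Definition dprod_inv (x : P) : P := fun i => (x i)^-1.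

Lemma dprod_mulA : associative dprod_mul.
Proof. by move=> x y z; apply: functional_extensionality_dep => i; apply: mulgA. Qed.
Lemma dprod_mul1 : left_id dprod_one dprod_mul.
Proof. by move=> x; apply: functional_extensionality_dep => i; apply: mul1g. Qed.
Lemma dprod_mul1r : right_id dprod_one dprod_mul.
Proof. by move=> x; apply: functional_extensionality_dep => i; apply: mulg1. Qed.
Lemma dprod_mulV : left_inverse dprod_one dprod_inv dprod_mul.
Proof. by move=> x; apply: functional_extensionality_dep => i; apply: mulVg. Qed.
Lemma dprod_mulVr : right_inverse dprod_one dprod_inv dprod_mul.
Proof. by move=> x; apply: functional_extensionality_dep => i; apply: mulgV. Qed.

HB.instance Definition _ := isGroup.Build P
  dprod_mulA dprod_mul1 dprod_mul1r dprod_mulV dprod_mulVr.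

Lemma dprod_mul_continuous : continuous (fun x : P * P => x.1 * x.2).
Proof.
apply: dprod_continuous => i.
have cp := @dprod_proj_continuous i.
apply: (@continuous_mulg (K i) _ (fun x : P * P => x.1 i) (fun x => x.2 i)) => x.
  by apply: (@continuous_comp _ _ _ fst (fun z : P => z i)); [exact: cvg_fst|exact: cp].
by apply: (@continuous_comp _ _ _ snd (fun z : P => z i)); [exact: cvg_snd|exact: cp].
Qed.

Lemma dprod_inv_continuous : continuous (fun x : P => x^-1).
Proof.
apply: dprod_continuous => i; apply: (@continuous_invg (K i) _ (fun x : P => x i)).
exact: dprod_proj_continuous.
Qed.

HB.instance Definition _ := isTopologicalGroup.Build P
  dprod_mul_continuous dprod_inv_continuous.

Lemma dprod_compact : compact [set: P].
Proof.
have := @tychonoff I K (fun=> setT) (fun i => @profinite_compact (K i)).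
by congr compact; apply/seteqP.
Qed.

Lemma dprod_hausdorff : hausdorff_space P.
Proof.
exact: (@hausdorff_product I K (fun i => @profinite_hausdorff (K i))).
Qed.

Lemma dprod_totally_disconnected : totally_disconnected [set: P].
Proof.
have := @totally_disconnected_prod I K (fun=> setT)
  (fun i => @profinite_totally_disconnected (K i)).
by congr totally_disconnected; apply/seteqP.
Qed.

HB.instance Definition _ := TopologicalGroup_isProfinite.Build P
  dprod_compact dprod_hausdorff dprod_totally_disconnected.

End Product.

(** Bundled, so that the subtype cs_type can carry canonical structures. *)
Record closed_subgroup (P : profiniteGroupType) := ClosedSubgroup {
  cs_set :> set P;
  cs_subgroup : subgroup cs_set;
  cs_closed : closed cs_set
}.

Definition cs_type (P : profiniteGroupType) (H : closed_subgroup P) : Type :=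
  set_type H.

Section ClosedSubgroups.
Variables (P : profiniteGroupType) (H : closed_subgroup P).
Local Notation T := (cs_type H).

HB.instance Definition _ := Topological.copy T (set_type H).

Definition cs_val (x : T) : P := val (x : set_type H).

Lemma cs_val_inj : injective cs_val.
Proof. exact: val_inj. Qed.

Lemma cs_valP (x : T) : cs_set H (cs_val x).
Proof. exact: set_valP. Qed.

Definition cs_sub (x : P) (Hx : cs_set H x) : T := exist _ x (mem_set Hx).

Lemma cs_subK x (Hx : cs_set H x) : cs_val (cs_sub Hx) = x.
Proof. by []. Qed.

Lemma cs_val_continuous : continuous cs_val.
Proof. exact: (@initial_continuous (set_type H) P set_val). Qed.

Lemma cs_continuous (U : topologicalType) (f : U -> T) :
  continuous (cs_val \o f) -> continuous f.
Proof.
move=> fc u V [_ [[B oB <-] Bfu BV]].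
apply: (@filterS _ (nbhs u) _ (f @^-1` (cs_val @^-1` B))).
  by move=> v /BV.
by apply: (fc u B); apply: open_nbhs_nbhs.
Qed.

Let HS := cs_subgroup H.
Lemma cs1 : cs_set H 1. Proof. by have [] := HS. Qed.
Lemma csM (x y : T) : cs_set H (cs_val x * cs_val y).
Proof. by have [_ HM _] := HS; apply: HM; apply: cs_valP. Qed.
Lemma csV (x : T) : cs_set H (cs_val x)^-1.
Proof. by have [_ _ HV] := HS; apply: HV; apply: cs_valP. Qed.

Definition cs_one : T := cs_sub cs1.
Definition cs_mul (x y : T) : T := cs_sub (csM x y).
Definition cs_inv (x : T) : T := cs_sub (csV x).

Lemma cs_mulA : associative cs_mul.
Proof. by move=> x y z; apply: cs_val_inj; rewrite !cs_subK mulgA. Qed.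
Lemma cs_mul1 : left_id cs_one cs_mul.
Proof. by move=> x; apply: cs_val_inj; rewrite !cs_subK mul1g. Qed.
Lemma cs_mul1r : right_id cs_one cs_mul.
Proof. by move=> x; apply: cs_val_inj; rewrite !cs_subK mulg1. Qed.
Lemma cs_mulV : left_inverse cs_one cs_inv cs_mul.
Proof. by move=> x; apply: cs_val_inj; rewrite !cs_subK mulVg. Qed.
Lemma cs_mulVr : right_inverse cs_one cs_inv cs_mul.
Proof. by move=> x; apply: cs_val_inj; rewrite !cs_subK mulgV. Qed.

HB.instance Definition _ := isGroup.Build T
  cs_mulA cs_mul1 cs_mul1r cs_mulV cs_mulVr.

Lemma cs_mul_continuous : continuous (fun x : T * T => x.1 * x.2).
Proof.
apply: cs_continuous.
have cv := cs_val_continuous.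
apply: (@continuous_mulg P _ (fun x : T * T => cs_val x.1) (fun x => cs_val x.2)) => x.
  by apply: (@continuous_comp _ _ _ fst cs_val); [exact: cvg_fst|exact: cv].
by apply: (@continuous_comp _ _ _ snd cs_val); [exact: cvg_snd|exact: cv].
Qed.

Lemma cs_inv_continuous : continuous (fun x : T => x^-1).
Proof.
apply: cs_continuous; apply: (@continuous_invg P _ cs_val).
exact: cs_val_continuous.
Qed.

HB.instance Definition _ := isTopologicalGroup.Build T
  cs_mul_continuous cs_inv_continuous.

Lemma cs_compact : compact [set: T].
Proof.
move=> F FF _; have cH : compact (cs_set H).
  by apply: subclosed_compact (@profinite_compact P) _ => //; exact: cs_closed.
have [|x [Hx Fx]] := cH (cs_val @ F) _.
  by apply: (@filterS _ F _ setT); [move=> y _; exact: cs_valP|exact: filterT].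
exists (cs_sub Hx); split=> // A V FA [_ [[B oB <-] Bx BV]].
have [||y [[z Az zy] By]] := Fx (cs_val @` A) B.
- by apply: (@filterS _ F _ A) => // z Az; exists z.
- by apply: open_nbhs_nbhs.
- by exists z; split=> //; apply: (BV z); rewrite -zy in By.
Qed.

Lemma cs_clopen_separation (x y : T) : x != y ->
  exists U : set T, [/\ clopen U, U x & ~ U y].
Proof.
move=> /eqP nxy; have [|U [cU Ux nUy]] := @clopen_separation P (cs_val x) (cs_val y)
  (@profinite_compact P) (@profinite_hausdorff P)
  (@profinite_totally_disconnected P).
  by move=> /cs_val_inj.
exists (cs_val @^-1` U); split=> //.
by apply: preimage_clopen => //; exact: cs_val_continuous.
Qed.

Lemma cs_hausdorff : hausdorff_space T.
Proof.
move=> x y xy; apply: contrapT => /eqP /cs_clopen_separation[U [[oU cU] Ux nUy]].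
have [||z [Uz nUz]] := xy U (~` U) => //.
- exact: open_nbhs_nbhs.
- by apply: open_nbhs_nbhs; split=> //; exact: closed_openC.
Qed.

HB.instance Definition _ := TopologicalGroup_isProfinite.Build T
  cs_compact cs_hausdorff (zero_dimension_totally_disconnected cs_clopen_separation).

End ClosedSubgroups.

Arguments cs_val {P H}.

(** * The free profinite group on a set *)

(** The homomorphisms to the finite quotients of D are compatible because they
    agree on generators.  A point of D with prescribed compatible images in all
    of them exists by compactness, and it is unique because the open normal
    subgroups intersect trivially. *)
Lemma extend_from_finite_quotients (F D : profiniteGroupType) (S : set F)
    (phi0 : F -> D) :
  generates S ->
  (forall (gT : finGroupType) (q : D -> disc gT), epimorphism q ->
    exists phi : F -> disc gT,
      continuous_hom phi /\ forall s, S s -> phi s = q (phi0 s)) ->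
  exists phi : F -> D, continuous_hom phi /\ forall s, S s -> phi s = phi0 s.
Proof.
move=> genS ext.
pose J := {N : set D | open N /\ normal_subgroup N}.
have qP (N : J) : exists z :
    {gT : finGroupType & ((D -> disc gT) * (F -> disc gT))%type},
    [/\ epimorphism (tagged z).1, hom_ker (tagged z).1 = sval N,
      continuous_hom (tagged z).2 &
      forall s, S s -> (tagged z).2 s = (tagged z).1 (phi0 s)].
  case: N => N [oN nN].
  have [n [H [q [qE qk]]]] := finite_quotient_disc oN nN.
  have [phi [phiH phiS]] := ext _ q qE.
  by exists (existT (fun gT : finGroupType => ((D -> disc gT) * (F -> disc gT))%type)
    (subg_of H : finGroupType) (q, phi)).
have [z zP] := choice qP.
pose gT N := tag (z N); pose q N : D -> disc (gT N) := (tagged (z N)).1.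
pose phiN N : F -> disc (gT N) := (tagged (z N)).2.
have qE N : epimorphism (q N) by case: (zP N).
have qH N : monoid_morphism (q N) by case: (qE N) => -[].
have qS N y : exists x, q N x = y.
  by have [_ qS] := qE N; have [x _] := qS y I; exists x.
have qk N : hom_ker (q N) = sval N by case: (zP N).
have phiH N : continuous_hom (phiN N) by case: (zP N).
have phiS N s : S s -> phiN N s = q N (phi0 s) by case: (zP N) => _ _ _; apply.
have compat (N N' : J) x y : sval N' `<=` sval N ->
    q N' y = phiN N' x -> q N y = phiN N x.
  (* the transition map from the quotient by N' to the quotient by N sends g
     to q N (r g) *)
  move=> N'N qy; have [r rP] := choice (qS N').
  have rE d : q N (r (q N' d)) = q N d.
    apply/(hom_eq (qH N)); suff : hom_ker (q N) ((r (q N' d))^-1 * d) by [].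
    by rewrite qk; apply: N'N; rewrite -qk; apply/(hom_eq (qH N')).
  have rH : continuous_hom (fun g : disc (gT N') => q N (r g)).
    split; last exact: disc_continuous.
    split; first by rewrite /= -[X in r X](hom1 (qH N')) rE (hom1 (qH N)).
    move=> g h; have -> : g * h = q N' (r g * r h) by rewrite (homM (qH N')) !rP.
    by rewrite rE (homM (qH N)).
  have := hom_eq_on_generators genS (continuous_hom_comp (phiH N') rH) (phiH N).
  have Srs s : S s -> ((fun g : disc (gT N') => q N (r g)) \o phiN N') s = phiN N s.
    by move=> Ss /=; rewrite !phiS // rE.
  move=> /(_ Srs) /(congr1 (fun h => h x)) <- /=.
  by rewrite -qy rE.
have uniq y y' : (forall N, q N y = q N y') -> y = y'.
  move=> qyy; apply: contrapT => nyy.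
  have n1 : y^-1 * y' <> 1 by move=> E; apply: nyy; rewrite -[y]mulg1 -E mulVKg.
  have [N [oN nN]] := open_normal_separation n1; apply.
  pose NJ : J := exist _ N (conj oN nN).
  by rewrite -[N]/(sval NJ) -qk; apply/(hom_eq (qH NJ)); exact: qyy.
have T0 : J.
  exists setT; split; first exact: openT.
  by [].
have ex_phi x : exists y, forall N, q N y = phiN N x.
  apply: (@compact_directed D J (fun N => [set y | q N y = phiN N x]) T0).
  - exact: profinite_compact.
  - move=> N; have [[_ qc] _] := qE N.
    rewrite [X in closed X](_ : _ = q N @^-1` [set phiN N x]) //.
    by move/continuous_closedP: qc; apply; exact: discrete_closed.
  - move=> N N'; have [[oN nN] [oN' nN']] := (svalP N, svalP N').
    pose NN : J := exist (fun N => open N /\ normal_subgroup N) _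
      (conj (openI oN oN') (normal_subgroupI nN nN')).
    by exists NN => y /= yE; split; apply: (compat _ NN) => // w [].
  - by move=> N; have [y] := qS N (phiN N x); exists y.
have [phi phiP] := choice ex_phi.
have phi_hom : monoid_morphism phi.
  split; first by apply: uniq => N; rewrite phiP (hom1 (qH N)) (hom1 (phiH N).1).
  move=> a b; apply: uniq => N.
  by rewrite phiP (homM (qH N)) (homM (phiH N).1) !phiP.
exists phi; split; last by move=> s Ss; apply: uniq => N; rewrite phiP phiS.
split=> //; apply: closed_graph_continuous.
- exact: profinite_compact.
- exact: profinite_compact.
- exact: profinite_hausdorff.
have -> : [set p | phi p.1 = p.2] =
    \bigcap_(N in [set: J]) ((fun p : F * D => (phiN N p.1)^-1 * q N p.2) @^-1` [set 1]).
  apply/seteqP; split=> p /=; first by move=> E N _ /=; rewrite -E phiP mulVg.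
  move=> H; apply: uniq => N; rewrite phiP.
  by have /= E := H N I; rewrite -[LHS]mulg1 -E mulVKg.
apply: closed_bigI => N _.
have : continuous (fun p : F * D => (phiN N p.1)^-1 * q N p.2 : disc (gT N)).
  have [_ phic] := phiH N; have [[_ qc] _] := qE N.
  apply: continuous_mulg => [|x].
    apply: continuous_invg => x.
    by apply: (@continuous_comp _ _ _ fst (phiN N)); [exact: cvg_fst|exact: phic].
  by apply: (@continuous_comp _ _ _ snd (q N)); [exact: cvg_snd|exact: qc].
by move/continuous_closedP; apply; exact: discrete_closed.
Qed.

Section FreeProfinite.
Variable M : Type.

(** By Cayley's theorem symmetric groups suffice as targets, which avoids
    indexing by all finite groups. *)
Definition free_index : Type :=
  {n : nat & {phi : M -> 'S_n | finite_set [set m | phi m <> 1]}}.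

Local Notation P := (dprod (fun i : {classic free_index} =>
  disc 'S_(tag (i : free_index)) : profiniteGroupType)).

(** The free group is the closed subgroup generated by these elements, whose
    coordinates are all the finitely supported maps from M to symmetric groups. *)
Definition free_gen_prod (m : M) : P := fun i => sval (tagged (i : free_index)) m.

Definition free_closed_subgroup : closed_subgroup P :=
  ClosedSubgroup (smallest_closed_subgroup (range free_gen_prod)).1
    (smallest_closed_subgroup (range free_gen_prod)).2.

Definition free_group : Type := cs_type free_closed_subgroup.
HB.instance Definition _ := ProfiniteGroup.on free_group.

Lemma free_gen_in (m : M) : cs_set free_closed_subgroup (free_gen_prod m).
Proof. by move=> H [_ SH]; apply: SH; exists m. Qed.

Definition free_gen (m : M) : free_group := cs_sub (free_gen_in m).

Definition free_eval (i : free_index) (x : free_group) : disc 'S_(tag i) :=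
  cs_val x i.

Lemma free_eval_hom i : continuous_hom (free_eval i).
Proof.
split; first by split.
move=> x; apply: (@continuous_comp _ _ _ (@cs_val P free_closed_subgroup)
   (fun y : P => y i)); first exact: cs_val_continuous.
exact: dprod_proj_continuous.
Qed.

Lemma free_gen_inj : injective free_gen.
Proof.
move=> m m' mm'; apply: contrapT => nmm.
pose phi x : 'S_2 := if pselect (x = m) then tperm ord0 ord_max else 1.
have finphi : finite_set [set x | phi x <> 1].
  apply: sub_finite_set (finite_set1 m) => x; rewrite /phi /=.
  by case: pselect.
have phim : phi m = tperm ord0 ord_max by rewrite /phi; case: pselect.
have phim' : phi m' = 1 by rewrite /phi; case: pselect => // E; case: nmm.
pose i : free_index := existT _ 2 (exist _ phi finphi).
have : phi m = phi m' := congr1 (free_eval i) mm'.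
by rewrite phim phim' => /permP/(_ ord0); rewrite tpermL perm1.
Qed.

Lemma free_gen_generates : generates (range free_gen).
Proof.
apply/seteqP; split=> // x _ K [[sK cK] bK].
have : (cs_val @` K) (cs_val x).
  apply: (set_valP x); split; last first.
    by move=> _ [m _ <-]; exists (free_gen m) => //; apply: bK; exists m.
  split; last first.
    apply: continuous_image_closed => //; [exact: profinite_compact|
      exact: profinite_hausdorff|exact: cs_val_continuous].
  have [K1 KM KV] := sK; split.
  - by exists 1.
  - by move=> _ _ [a Ka <-] [b Kb <-]; exists (a * b) => //; apply: KM.
  - by move=> _ [a Ka <-]; exists a^-1 => //; apply: KV.
by move=> [y Ky /cs_val_inj <-].
Qed.

(** An open subgroup contains the common kernel of finitely many coordinates,
    and each coordinate is trivial on almost all generators. *)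
Lemma free_gen_converges : converges_to_1 (range free_gen).
Proof.
move=> N oN [[N1 _ _] _].
have [||s sN] := @compact_finite_inter free_group free_index
    (fun i => hom_ker (free_eval i)) N (@profinite_compact _) _ oN.
- move=> i; have [_ /continuous_closedP] := free_eval_hom i; apply.
  exact: discrete_closed.
- move=> x x1; suff -> : x = 1 by [].
  apply: cs_val_inj; apply: functional_extensionality_dep => i; exact: x1.
suff fin : finite_set
    [set m | ~ all (fun i => `[< hom_ker (free_eval i) (free_gen m) >]) s].
  apply: sub_finite_set (finite_image free_gen fin) => _ [[m _ <-] nN].
  by exists m => // /sN.
elim: s {sN} => [|i s IHs] /=.
  by apply: sub_finite_set (finite_set0 _) => x /=; case.
have := conj (svalP (tagged i)) IHs; rewrite -finite_setU.
apply: sub_finite_set.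
move=> m /= /negP; rewrite negb_and => /orP[/asboolP nm|/negP]; last by right.
by left => im; apply: nm.
Qed.

(** Followed by an embedding of D into 'S_n, phi0 is one of the coordinates of
    the free group; this coordinate takes values in D because it does so on the
    generators. *)
Lemma free_gen_extension_finite (D : profiniteGroupType) (phi0 : M -> D) :
  finite_set [set: D] -> finite_set [set m | phi0 m <> 1] ->
  exists phi : free_group -> D,
    continuous_hom phi /\ forall m, phi (free_gen m) = phi0 m.
Proof.
move=> finD fin0.
have o1 : open [set (1 : D)] by exact: finite_open.
have n1 : normal_subgroup [set (1 : D)].
  split; first split => //=.
  - by move=> x y -> ->; rewrite mulg1.
  - by move=> x ->; rewrite invg1.
  - by move=> x g ->; rewrite /= conj1g.
have [n [H [q [qH qS qk]]]] := finite_quotient o1 n1.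
have qI : injective q.
  move=> x y /(hom_eq qH) /qk /= E; by rewrite -[x]mulg1 -E mulVKg.
pose phiS m : 'S_n := sgval (q (phi0 m)).
have finS : finite_set [set m | phiS m <> 1].
  apply: sub_finite_set fin0 => m /= nm p1; apply: nm.
  by rewrite /phiS p1 hom1.
pose i : free_index := existT _ n (exist _ phiS finS).
have [evH evc] := free_eval_hom i.
pose K := [set x : free_group | exists d, sgval (q d) = free_eval i x].
have Kall x : K x.
  have : [set: free_group] x by [].
  rewrite -free_gen_generates; apply; split; last first.
    by move=> _ [m _ <-]; exists (phi0 m).
  split.
    split.
    - by exists 1; rewrite !hom1.
    - move=> a b [c cE] [d dE]; exists (c * d).
      by rewrite [q _]homM // [free_eval i _]homM // -cE -dE.
    - move=> a [c cE]; exists c^-1.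
      by rewrite [q _]homV // [free_eval i _]homV // -cE.
  have -> : K = free_eval i @^-1` [set p | exists d, sgval (q d) = p] by [].
  by move/continuous_closedP: evc; apply; exact: discrete_closed.
have [phi phiP] := choice Kall.
have qsI x y : sgval (q x) = sgval (q y) -> x = y by move=> /val_inj /qI.
have phiH : monoid_morphism phi.
  split; first by apply: qsI; rewrite phiP !hom1.
  by move=> x y; apply: qsI; rewrite phiP homM // [q _]homM // -!phiP.
exists phi; split; last by move=> m; apply: qsI; rewrite phiP.
split=> //; apply: open_ker_continuous => //.
have -> : hom_ker phi = hom_ker (free_eval i).
  apply/seteqP; split=> x; rewrite /hom_ker /=.
    by move=> x1; rewrite -phiP x1 hom1.
  by move=> x1; apply: qsI; rewrite phiP x1 hom1.
exact: (finite_ker_open evc (@disc_finite 'S_n)).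
Qed.

Lemma free_gen_extension (D : profiniteGroupType) (phi0 : free_group -> D) :
  map_converges_to_1 (range free_gen) phi0 ->
  exists phi : free_group -> D,
    continuous_hom phi /\ forall s, range free_gen s -> phi s = phi0 s.
Proof.
move=> cphi; apply: extend_from_finite_quotients; first exact: free_gen_generates.
move=> gT q qE; have [[qH qc] _] := qE.
have [||phi [phiH phiE]] :=
  @free_gen_extension_finite (disc gT) (fun m => q (phi0 (free_gen m))).
- exact: disc_finite.
- have fin := cphi (hom_ker q) (finite_ker_open qc (@disc_finite gT)) (hom_ker_normal qH).
  apply/finite_setPn => /card_leTl[e eI]; move/finite_setPn: fin; apply.
  apply/card_leTl.
  have P (k : nat) : range free_gen (free_gen (sval (e k))) /\
      ~ hom_ker q (phi0 (free_gen (sval (e k)))).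
    by split; [exists (sval (e k))|exact: (svalP (e k))].
  exists (fun k => exist _ (free_gen (sval (e k))) (P k)) => k l.
  by move=> /(congr1 sval) /= /free_gen_inj /sval_inj /eI.
by exists phi; split=> // _ [m _ <-].
Qed.

End FreeProfinite.

(** * Back and forth *)

Section Correspondences.
Variables A B : profiniteGroupType.

(** By Goursat's lemma these are the isomorphisms A / L -> B / L' between
    quotients by closed normal subgroups, with L and L' the fibres of R over
    1. *)
Definition correspondence (R : set (A * B)) : Prop :=
  [/\ closed R, subgroup R, forall a, exists b, R (a, b) &
      forall b, exists a, R (a, b)].

Definition small (M : Type) (R : set (A * B)) : Prop :=
  exists (J : Type) (C : J -> set (A * B)),
    [/\ ~ embeds M J, forall j, clopen (C j) & R = \bigcap_(j in [set: J]) C j].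

Lemma small_setI M R C : embeds nat M -> small M R -> clopen C -> small M (R `&` C).
Proof.
move=> Minf [J [D [MJ cD ->]]] cC.
exists (option J), (fun o => if o is Some j then D j else C); split.
- by move=> /(embeds_option Minf).
- by case.
- apply/seteqP; split=> [p [Dp Cp] [j|] _|p Dp]; [exact: Dp|by []|].
  by split=> [j _|]; [apply: (Dp (Some j))|apply: (Dp None)].
Qed.

Lemma clopen_slice (C : set (A * B)) : clopen C -> clopen [set b | C (1, b)].
Proof.
move=> cC; have pc : continuous (fun b : B => ((1 : A), b)).
  by move=> b; apply: cvg_pair; [exact: cvg_cst|exact: cvg_id].
exact: (preimage_clopen cC pc).
Qed.

(** A homomorphism that is trivial on N is determined by its values on coset
    representatives. *)
Lemma homs_killing_open_finite (gT : finGroupType) (N : set B) :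
  subgroup N -> open N -> exists (F : finType)
    (code : (B -> disc gT) -> F), forall lam mu,
    monoid_morphism lam -> monoid_morphism mu ->
    N `<=` hom_ker lam -> N `<=` hom_ker mu -> code lam = code mu -> lam = mu.
Proof.
move=> sN oN; have [s sP] := open_cosets_finite sN oN.
exists ((size s).-tuple gT), (fun lam => [tuple of map (lam : B -> gT) (in_tuple s)]).
move=> lam mu lamH muH Nlam Nmu /(congr1 val) /= /eq_in_map lm.
apply/funext => x; have [y ys Ny] := sP x.
have lam1 : lam (y^-1 * x) = 1 := Nlam _ Ny.
have mu1 : mu (y^-1 * x) = 1 := Nmu _ Ny.
by rewrite -(mulVKg y x) (homM lamH) (homM muH) lam1 mu1 (lm y ys).
Qed.

(** A homomorphism to a finite group that is trivial on the intersection L'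
    of fewer than M clopen sets is, by compactness, trivial on an open
    subgroup chosen from finitely many of them, and only finitely many
    homomorphisms are trivial on a given open subgroup. *)
Lemma few_homs_killing_fiber (M : Type) (R : set (A * B)) (gT : finGroupType) :
  embeds nat M -> small M R -> R 1 ->
  ~ embeds M {lam : B -> disc gT | continuous_hom lam /\
      forall b, R (1, b) -> lam b = 1}.
Proof.
move=> Minf [J [C [MJ cC RE]]] R1 Mlam.
(* N s is an open normal subgroup inside the fibre over 1 of the intersection
   of the sets in s *)
pose Ns (s : seq J) := [set b | all (fun j => `[< C j (1, b) >]) s].
have NsP s : exists N : set B, [/\ open N, normal_subgroup N & N `<=` Ns s].
  have [cNs Ns1] : clopen (Ns s) /\ Ns s 1.
    rewrite /Ns; elim: s => [|j s [cNs Ns1]].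
      by rewrite all_set_nil; split=> //; exact: clopenT.
    rewrite (all_set_cons (fun j => [set b | C j (1, b)])); split.
      by apply: clopenI => //; apply: clopen_slice.
    by split=> //=; move: R1; rewrite RE; apply.
  exact: open_normal_in_clopen.
have [N NP] := choice NsP.
have /choice[F FP] : forall s : seq J, exists F : finType, exists
    code : (B -> disc gT) -> F, forall lam mu,
    monoid_morphism lam -> monoid_morphism mu ->
    N s `<=` hom_ker lam -> N s `<=` hom_ker mu -> code lam = code mu -> lam = mu.
  move=> s; have [oN [sN _] _] := NP s.
  by have [F H] := homs_killing_open_finite gT sN oN; exists F.
pose code s := projT1 (cid (FP s)).
have codeI s := projT2 (cid (FP s)).
have [finJ|/infinite_embeds Jinf] := pselect (finite_set [set: J]).
  have [s sE] : exists s : seq J, forall b, Ns s b -> R (1, b).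
    have [s sE] : exists s : seq {classic J}, [set: {classic J}] = [set` s].
      exact/finite_seqP.
    exists s => b /(@allP {classic J} _ s) sb; rewrite RE => j _.
    have js : (j : {classic J}) \in s.
      by have : [set: {classic J}] j by []; rewrite sE.
    by have /asboolP := sb j js.
  apply: (@finType_not_infinite (F s)); apply: embeds_trans Minf (embeds_trans Mlam _).
  have [_ _ NNs] := NP s.
  exists (fun lam => code s (sval lam)) => lam mu E; apply: sval_inj.
  have [[lamH _] lamL] := svalP lam; have [[muH _] muL] := svalP mu.
  apply: (codeI s) => //.
    by move=> b Nb; apply/lamL/sE/NNs.
  by move=> b Nb; apply/muL/sE/NNs.
have lamP (lam : {lam : B -> disc gT | continuous_hom lam /\
    forall b, R (1, b) -> lam b = 1}) : exists s, N s `<=` hom_ker (sval lam).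
  have [[lamH lamc] lamL] := svalP lam.
  have [|||s sE] := @compact_finite_inter B J (fun j => [set b | C j (1, b)])
      (hom_ker (sval lam)) (@profinite_compact B).
  - by move=> j; have [_] := clopen_slice (cC j).
  - exact: (finite_ker_open lamc (@disc_finite gT)).
  - by move=> b Cb; apply: lamL; rewrite RE => j _; apply: Cb.
  by exists s => b Nb; apply: sE; have [_ _] := NP s; apply.
have [sl slP] := choice lamP.
apply: MJ; apply: embeds_trans Mlam _.
apply: embeds_trans (embeds_nat_prod Jinf).
have [e eI] := embeds_seq_self Jinf.
exists (fun lam => (pickle (code (sl lam) (sval lam)), e (sl lam))).
move=> lam mu [E /eI E2]; apply: sval_inj.
have [[lamH _] _] := svalP lam; have [[muH _] _] := svalP mu.
apply: (codeI (sl lam)) => //; first by rewrite E2; apply: slP.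
by apply: (pcan_inj pickleK); rewrite -/(code _ _) E E2.
Qed.

End Correspondences.

Lemma epi_image_group (G : profiniteGroupType) (N : set G) (gT : finGroupType)
    (q : G -> disc gT) :
  normal_subgroup N -> epimorphism q ->
  exists K : {group gT},
    (forall g, g \in K <-> exists2 a, N a & q a = g) /\ [set: gT]%G \subset 'N(K).
Proof.
move=> [[N1 NM _] NJ] [[qH _] qS].
pose K := finset (fun g : gT => `[< exists2 a, N a & q a = g >]).
have KP g : reflect (exists2 a, N a & q a = g) (g \in K).
  by rewrite inE; apply: asboolP.
have gK : group_set K.
  apply/group_setP; split; first by apply/KP; exists 1 => //; rewrite hom1.
  move=> _ _ /KP[a Na <-] /KP[a' Na' <-]; apply/KP.
  by exists (a * a'); [exact: NM|exact: homM].
exists (Group gK); split=> [g|]; first by split=> /KP.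
apply/fintype.subsetP => x _; rewrite inE.
apply/fintype.subsetP => _ /imsetP[g /KP[a Na <-] ->].
have [y _ yx] := qS x I; apply/KP; exists (a ^ y); first exact: NJ.
by rewrite homJ // yx.
Qed.

Section Refinement.
Variables (A B : profiniteGroupType) (M : Type).
Hypothesis Minf : embeds nat M.
Hypothesis richB : rich B M.
Implicit Type R : set (A * B).

Lemma corrM R a b a' b' : correspondence R -> R (a, b) -> R (a', b') ->
  R (a * a', b * b').
Proof. by move=> [_ [_ RM _] _ _] /RM H /H. Qed.

Lemma corrV R a b : correspondence R -> R (a, b) -> R (a^-1, b^-1).
Proof. by move=> [_ [_ _ RV] _ _] /RV. Qed.

Lemma corr1 R : correspondence R -> R (1, 1).
Proof. by move=> [_ [R1 _ _] _ _]. Qed.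

Lemma corr_left_normal R : correspondence R -> normal_subgroup [set a | R (a, 1)].
Proof.
move=> cR; have [_ _ sur _] := cR.
split; first split=> [|a a' Ra Ra'|a Ra]; rewrite /=.
- exact: corr1.
- by rewrite -(mulg1 1); apply: corrM.
- by rewrite -invg1; apply: corrV.
- move=> a g Ra; have [b Rb] := sur g.
  have := corrM cR (corrV cR Rb) (corrM cR Ra Rb).
  by rewrite mul1g mulVg.
Qed.

Lemma corr_right_normal R : correspondence R -> normal_subgroup [set b | R (1, b)].
Proof.
move=> cR; have [_ _ _ sur] := cR.
split; first split=> [|b b' Rb Rb'|b Rb]; rewrite /=.
- exact: corr1.
- by rewrite -(mulg1 1); apply: corrM.
- by rewrite -invg1; apply: corrV.
- move=> b g Rb; have [a Ra] := sur g.
  have := corrM cR (corrV cR Ra) (corrM cR Rb Ra).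
  by rewrite mul1g mulVg.
Qed.

Lemma coset_hom (gT : finGroupType) (K : {group gT}) :
  [set: gT]%G \subset 'N(K) -> monoid_morphism (coset K).
Proof.
move=> nK; have N x : x \in 'N(K) by apply: (fintype.subsetP nK); rewrite inE.
by split=> [|x y]; [rewrite morph1|rewrite morphM].
Qed.

Lemma coset_eq1 (gT : finGroupType) (K : {group gT}) g :
  [set: gT]%G \subset 'N(K) -> coset K g = 1 <-> g \in K.
Proof.
move=> nK; have N x : x \in 'N(K) by apply: (fintype.subsetP nK); rewrite inE.
by split=> [/coset_idr-/(_ (N g))|/coset_id].
Qed.

(** Let alpha : B -> gT / K be the map induced by R and q.  It has M lifts
    lam : B -> gT, and fewer than M homomorphisms are trivial on L', so some
    lift is not.  Then lam (L') is a non-trivial normal subgroup of gT inside the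
    minimal normal subgroup K, hence all of K, and this is what keeps both
    projections surjective when q a = lam b is imposed on R. *)
Lemma refine_minimal R (gT : finGroupType) (q : A -> disc gT) (K : {group gT}) :
  small M R -> correspondence R -> epimorphism q ->
  (forall g, g \in K <-> exists2 a, R (a, 1) & q a = g) ->
  minnormal K [set: gT]%G ->
  exists C, [/\ clopen C, correspondence (R `&` C) &
    forall a, (R `&` C) (a, 1) -> q a = 1].
Proof.
move=> sR cR qE KP /mingroupP[/andP[ntK nK] minK].
have [[qH qc] qS] := qE; have [cl_R subR surA surB] := cR.
pose c : gT -> coset_of K := coset K.
have cH : monoid_morphism c := coset_hom nK.
have c1 g : c g = 1 <-> g \in K := coset_eq1 g nK.
have cS h : exists g, c g = h.
  by have [g _ ->] := cosetP h; exists g.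
have ker_c : exists2 g, c g = 1 & g <> 1.
  have /trivgPn[g gK /eqP ng] := ntK.
  by exists g => //; apply/c1.
have qR a a' b : R (a, b) -> R (a', b) -> c (q a) = c (q a').
  move=> Ra Ra'; apply/(hom_eq cH)/c1/KP; exists (a^-1 * a').
    by have := corrM cR (corrV cR Ra) Ra'; rewrite mulVg.
  by rewrite (homM qH) (homV qH).
have [sigma sigmaP] := choice surB.
pose alpha (b : B) : disc (coset_of K) := c (q (sigma b)).
have alphaR a b : R (a, b) -> alpha b = c (q a).
  by move=> Rab; apply: qR (sigmaP b) Rab.
have alphaE : epimorphism alpha.
  split; last first.
    move=> h _; have [g <-] := cS h; have [a _ <-] := qS g I.
    by have [b Rab] := surA a; exists b => //; apply: alphaR.
  split.
    split; first by rewrite (alphaR 1 1 (corr1 cR)) (hom1 qH) (hom1 cH).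
    move=> b b'; rewrite (alphaR _ _ (corrM cR (sigmaP b) (sigmaP b'))).
    by rewrite (homM qH) (homM cH).
  apply/continuous_closedP => T _.
  have -> : alpha @^-1` T =
      snd @` (R `&` (fun p : A * B => q p.1) @^-1` [set g | T (c g)]).
    apply/seteqP; split=> [b Tb|_ [[a b] [/= Rab Tq] <-]].
      by exists (sigma b, b) => //; split=> //; apply: sigmaP.
    by rewrite /= (alphaR _ _ Rab).
  apply: continuous_image_closed.
  - by rewrite -setXTT; apply: compact_setX; exact: profinite_compact.
  - exact: profinite_hausdorff.
  - by move=> p; apply: cvg_snd.
  - apply: closedI => //.
    have : continuous (fun p : A * B => q p.1).
      by move=> p; apply: (@continuous_comp _ _ _ fst q); [exact: cvg_fst|exact: qc].
    by move/continuous_closedP; apply; exact: discrete_closed.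
have [lam [lamE lamc] lamL] : exists2 lam : B -> disc gT,
    epimorphism lam /\ (forall b, c (lam b) = alpha b) &
    ~ forall b, R (1, b) -> lam b = 1.
  apply: contrapT => nlam.
  have R1 : R 1 by exact: corr1.
  have few := @few_homs_killing_fiber A B M R gT Minf sR R1.
  apply: few.
  apply: embeds_trans (richB cH cS ker_c alphaE) _.
  have P (l : {lam : B -> disc gT | epimorphism lam /\ forall b, c (lam b) = alpha b}) :
      continuous_hom (sval l) /\ forall b, R (1, b) -> sval l b = 1.
    have lP := svalP l; split; first by case: lP => -[].
    by apply: contrapT => nl; apply: nlam; exists (sval l).
  exists (fun l => exist _ (sval l) (P l)) => l l' E.
  by apply: sval_inj; apply: (congr1 sval E).
have [[lamH lam_cont] lamS] := lamE.
have lamLK l : R (1, l) -> lam l \in K.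
  move=> Rl; apply/c1; rewrite lamc (alphaR _ _ Rl).
  by rewrite (hom1 qH) (hom1 cH).
have [K' [K'P nK']] := epi_image_group (corr_right_normal cR) lamE.
have KK' : K' :=: K.
  apply: minK.
    rewrite nK' andbT; apply/trivgPn; apply: contrapT => nt.
    apply: lamL => b Rb; apply: contrapT => nb; apply: nt.
    by exists (lam b); [apply/K'P; exists b|apply/eqP].
  by apply/fintype.subsetP => g /K'P[b Rb <-]; apply: lamLK.
pose C := [set p : A * B | q p.1 = lam p.2].
exists C.
have cC : clopen C.
  have -> : C = (fun p : A * B => (q p.1)^-1 * lam p.2 : disc gT) @^-1` [set 1].
    apply/seteqP; split=> p; rewrite /C /=; first by move=> ->; rewrite mulVg.
    by move=> E; rewrite -[LHS]mulg1 -E mulVKg.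
  apply: preimage_clopen; first by split; [exact: discrete_open|exact: discrete_closed].
  apply: continuous_mulg => [|x].
    apply: continuous_invg => x.
    by apply: (@continuous_comp _ _ _ fst q); [exact: cvg_fst|exact: qc].
  by apply: (@continuous_comp _ _ _ snd lam); [exact: cvg_snd|exact: lam_cont].
(* the discrepancy that has to be corrected within L or L' *)
have diffK a b : R (a, b) -> (lam b)^-1 * q a \in K.
  move=> Rab; apply/c1; rewrite (homM cH) (homV cH) lamc (alphaR _ _ Rab).
  by rewrite mulVg.
split=> //; last by move=> a [_]; rewrite /C /= => ->; rewrite (hom1 lamH).
split.
- by apply: closedI => //; case: cC.
- split.
  + by split; [exact: corr1|rewrite /C /= (hom1 qH) (hom1 lamH)].
  + move=> [a b] [a' b'] [Rab qab] [Rab' qab']; split; first exact: corrM Rab Rab'.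
    by rewrite /C /= (homM qH) (homM lamH) (qab : q a = lam b) (qab' : q a' = lam b').
  + move=> [a b] [Rab qab]; split; first exact: corrV Rab.
    by rewrite /C /= (homV qH) (homV lamH) (qab : q a = lam b).
- move=> a; have [b Rab] := surA a; have := diffK a b Rab.
  rewrite -KK' => /K'P[l Rl lE]; exists (b * l); split.
    by have := corrM cR Rab Rl; rewrite mulg1.
  by rewrite /C /= (homM lamH) lE mulVKg.
- move=> b; have [a Rab] := surB b; have := diffK a b Rab.
  move=> /groupVr; rewrite invgM invgK => /KP[l Rl lE]; exists (a * l); split.
    by have := corrM cR Rab Rl; rewrite mulg1.
  by rewrite /C /= (homM qH) lE mulVKg.
Qed.

(** Induction on the order of the image K = q (L).  For V maximal among the
    proper subgroups of K that are normal in gT, K / V is minimal normal in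
    gT / V, so refining modulo V is possible and shrinks the image of L into
    V. *)
Lemma refine_kernel R (gT : finGroupType) (q : A -> disc gT) :
  small M R -> correspondence R -> epimorphism q ->
  exists C, [/\ clopen C, correspondence (R `&` C) &
    forall a, (R `&` C) (a, 1) -> q a = 1].
Proof.
move=> sR cR qE.
have [K [KP nK]] := epi_image_group (corr_left_normal cR) qE.
have [n] := ubnP #|K|; elim: n => // n IHn in R sR cR K KP nK *.
rewrite ltnS => cardK; have [[qH qc] qS] := qE.
have [K1|ntK] := eqVneq (K : {set gT}) 1%g.
  exists setT; rewrite setIT; split=> //; first exact: clopenT.
  move=> a Ra; have : q a \in K by apply/KP; exists a.
  by rewrite K1 => /set1P.
have [V maxV] : {V : {group gT} | maxnormal V K [set: gT]%G}.
  by apply: ex_maxgroup; exists 1%G; rewrite proper1G ntK norms1.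
have /andP[ltVK nV] := maxgroupp maxV.
pose c : gT -> coset_of V := coset V.
have cH : monoid_morphism c := coset_hom nV.
pose q' : A -> disc (coset_of V) := fun a => c (q a).
have q'E : epimorphism q'.
  split; last first.
    move=> h _; have [g _ ->] := cosetP h; have [a _ <-] := qS g I.
    by exists a.
  apply: (@continuous_hom_comp A (disc gT) (disc (coset_of V)) q c) => //.
  by split=> //; exact: disc_continuous.
have KVP h : h \in (K / V)%G <-> exists2 a, R (a, 1) & q' a = h.
  split.
    by move=> /morphimP[g _ /KP[a Ra <-] ->]; exists a.
  move=> [a Ra <-]; apply/morphimP; exists (q a) => //.
    by apply: (fintype.subsetP nV); rewrite inE.
  by apply/KP; exists a.
have minKV : minnormal (K / V)%G [set: coset_of V]%G.
  have -> : [set: coset_of V]%G = ([set: gT] / V)%G.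
    apply: val_inj; apply/setP => h; rewrite inE; apply/esym.
    by have [g Ng ->] := cosetP h; apply: mem_quotient; rewrite inE.
  apply: maxnormal_minnormal => //.
  exact: fintype.subset_trans (finset.subsetT K) nV.
have [C1 [cC1 cR1 C1V]] := refine_minimal sR cR q'E KVP minKV.
have sR1 := small_setI Minf sR cC1.
have [K1 [K1P nK1]] := epi_image_group (corr_left_normal cR1) qE.
have K1V : K1 \subset V.
  apply/fintype.subsetP => g /K1P[a R1a <-].
  by apply/(coset_eq1 _ nV); exact: C1V.
have [|C2 [cC2 cR2 C2q]] := IHn _ sR1 cR1 K1 K1P nK1.
  apply: leq_ltn_trans (subset_leq_card K1V) _.
  exact: leq_trans (proper_card ltVK) cardK.
exists (C1 `&` C2); rewrite setIA; split=> //; exact: clopenI.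
Qed.

Lemma refine_left R (N : set A) :
  small M R -> correspondence R -> open N -> normal_subgroup N ->
  exists C, [/\ clopen C, correspondence (R `&` C) &
    forall a, (R `&` C) (a, 1) -> N a].
Proof.
move=> sR cR oN nN; have [n [H [q [qE qN]]]] := finite_quotient_disc oN nN.
have [C [cC cRC Cq]] := refine_kernel sR cR qE.
by exists C; split=> // a /Cq; rewrite -qN.
Qed.

End Refinement.

Lemma swap_correspondence (A B : profiniteGroupType) (R : set (A * B)) :
  correspondence R -> correspondence ([set p : B * A | R (p.2, p.1)]).
Proof.
move=> [cR [R1 RM RV] sA sB]; split=> //.
- have sc : continuous (fun p : B * A => (p.2, p.1)) by exact: swap_continuous.
  by move/continuous_closedP: sc; apply.
- by split=> [|[b a] [b' a'] /RM H /H|[b a] /RV].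
Qed.

Lemma swap_small (A B : profiniteGroupType) (M : Type) (R : set (A * B)) :
  small M R -> small M ([set p : B * A | R (p.2, p.1)]).
Proof.
move=> [J [C [MJ cC ->]]]; exists J, (fun j => [set p | C j (p.2, p.1)]); split=> //.
move=> j; have sc : continuous (fun p : B * A => (p.2, p.1)) by exact: swap_continuous.
exact: (preimage_clopen (cC j) sc).
Qed.

Lemma refine (A B : profiniteGroupType) (M : Type) (R : set (A * B))
    (N : set A) (N' : set B) :
  embeds nat M -> rich A M -> rich B M -> small M R -> correspondence R ->
  open N -> normal_subgroup N -> open N' -> normal_subgroup N' ->
  exists C, [/\ clopen C, correspondence (R `&` C),
    forall a, (R `&` C) (a, 1) -> N a & forall b, (R `&` C) (1, b) -> N' b].
Proof.
move=> Minf rA rB sR cR oN nN oN' nN'.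
have [C [cC cRC CN]] := refine_left Minf rB sR cR oN nN.
have sRC := small_setI Minf sR cC.
have [D [cD cRD DN]] :=
  refine_left Minf rA (swap_small sRC) (swap_correspondence cRC) oN' nN'.
pose D' := [set p : A * B | D (p.2, p.1)].
exists (C `&` D'); rewrite setIA; split.
- apply: clopenI => //.
  have sc : continuous (fun p : A * B => (p.2, p.1)) by exact: swap_continuous.
  exact: (preimage_clopen cD sc).
- have := swap_correspondence cRD; congr correspondence.
  by apply/seteqP; split=> -[a b].
- by move=> a [/CN].
- by move=> b [RCb Db]; apply: DN.
Qed.

(** By compactness of the fibres of the two projections. *)
Lemma nested_correspondences (A B : profiniteGroupType) (I : Type)
    (P : I -> set (A * B)) :
  (forall i, correspondence (P i)) ->
  (forall i j, P i `<=` P j \/ P j `<=` P i) ->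
  correspondence (\bigcap_(i in [set: I]) P i).
Proof.
move=> cP nestP.
have dir X (f : X -> A * B) i j : exists k, f @^-1` P k `<=` f @^-1` P i `&` f @^-1` P j.
  by case: (nestP i j) => sij; [exists i|exists j] => x Px; split=> //; apply: sij.
split.
- by apply: closed_bigI => i _; case: (cP i).
- split=> [i _|x y Px Py i _|x Px i _]; have [_ [P1 PM PV] _ _] := cP i => //.
    by apply: PM; [apply: Px|apply: Py].
  by apply: PV; apply: Px.
- move=> a; have [[i0]|I0] := pselect (inhabited I); last first.
    by exists 1 => i; case: I0.
  have fc : continuous (fun b : B => (a, b)).
    by move=> b; apply: cvg_pair; [exact: cvg_cst|exact: cvg_id].
  have [i|i j|i|b Pb] := @compact_directed B I (fun i => (fun b => (a, b)) @^-1` P i)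
    i0 (@profinite_compact B).
  + by have [cl _ _ _] := cP i; move/continuous_closedP: fc; apply.
  + exact: dir.
  + by have [_ _ sA _] := cP i; have [b] := sA a; exists b.
  + by exists b => i _; apply: Pb.
- move=> b; have [[i0]|I0] := pselect (inhabited I); last first.
    by exists 1 => i; case: I0.
  have fc : continuous (fun a : A => (a, b)).
    by move=> a; apply: cvg_pair; [exact: cvg_id|exact: cvg_cst].
  have [i|i j|i|a Pa] := @compact_directed A I (fun i => (fun a => (a, b)) @^-1` P i)
    i0 (@profinite_compact A).
  + by have [cl _ _ _] := cP i; move/continuous_closedP: fc; apply.
  + exact: dir.
  + by have [_ _ _ sB] := cP i; have [a] := sB b; exists a.
  + by exists a => i _; apply: Pa.
Qed.


(** Transfinite recursion over the well-order W: the clopen set C_w refines the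
    intersection of the previous ones so as to bring both fibres over 1 into
    the w-th pair of open normal subgroups.  Fewer than M sets precede each w,
    so every stage is small. *)
Theorem back_and_forth (A B : profiniteGroupType) (M : Type) :
  embeds nat M -> rich A M -> rich B M ->
  embeds {N : set A | open N /\ normal_subgroup N} M ->
  embeds {N : set B | open N /\ normal_subgroup N} M ->
  exists R : set (A * B), [/\ correspondence R,
    forall a, R (a, 1) -> a = 1 & forall b, R (1, b) -> b = 1].
Proof.
move=> Minf rA rB AM BM.
have [W [lt [wf_lt lt_trans lt_total MW segW]]] := initial_well_order M.
have enum (G : profiniteGroupType) :
    embeds {N : set G | open N /\ normal_subgroup N} M ->
    exists e : W -> set G, (forall w, open (e w) /\ normal_subgroup (e w)) /\
      forall N, open N -> normal_subgroup N -> exists w, e w = N.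
  move=> GM; have [f fI] := embeds_trans GM MW.
  pose e w : set G := if pselect (exists N, f N = w) is left H
    then sval (projT1 (cid H)) else setT.
  exists e; split=> [w|N oN nN].
    rewrite /e; case: pselect => [H|nH] /=; first exact: svalP (projT1 (cid H)).
    by split; first exact: openT.
  pose N' : {N : set G | open N /\ normal_subgroup N} := exist _ N (conj oN nN).
  exists (f N'); rewrite /e; case: pselect => [H|[]]; last by exists N'.
  by case: cid => N2 /= /fI ->.
have [e [eP e_all]] := enum A AM; have [e' [e'P e'_all]] := enum B BM.
pose good w (R C : set (A * B)) := [/\ clopen C, correspondence (R `&` C),
  forall a, (R `&` C) (a, 1) -> e w a & forall b, (R `&` C) (1, b) -> e' w b].
(* setT is a default value: goodP shows that a good set exists *)
pose step w (R : set (A * B)) : set (A * B) :=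
  if pselect (exists C, good w R C) is left H then projT1 (cid H) else setT.
pose C := Fix wf_lt (fun _ => set (A * B)) (fun w rec =>
  step w [set p | forall v (vw : lt v w), rec v vw p]).
pose Rl w := [set p | forall v, lt v w -> C v p].
have CE w : C w = step w (Rl w).
  rewrite /C Fix_eq // => {}w f g fg; congr step.
  by apply/seteqP; split=> p fp v vw; [rewrite -fg|rewrite fg]; apply: fp.
pose P w := Rl w `&` C w.
have PS v w : lt v w -> P w `<=` P v.
  by move=> vw p [Rp Cp]; split; [move=> u uv; apply: Rp; apply: lt_trans vw|apply: Rp].
have goodP w : good w (Rl w) (C w).
  elim: (wf_lt w) => {}w _ IH.
  have cR : correspondence (Rl w).
    have -> : Rl w = \bigcap_(v in [set: {v | lt v w}]) P (sval v).
      apply/seteqP; split=> p Rp v.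
        move=> _; split; last by apply: Rp; apply: svalP v.
        by move=> u uv; apply: Rp; apply: lt_trans (svalP v).
      by move=> vw; have [] := Rp (exist _ v vw) I.
    apply: nested_correspondences => [[v vw]|[u uw] [v vw]] /=.
      by case: (IH v vw).
    by case: (lt_total u v) => [/PS|->|/PS]; [right|left|left].
  have sR : small M (Rl w).
    exists {v | lt v w}, (fun v => C (sval v)); split; first exact: segW.
      by move=> [v vw] /=; case: (IH v vw).
    apply/seteqP; split=> p Rp v; first by move=> _; apply: Rp; apply: svalP v.
    by move=> vw; apply: (Rp (exist _ v vw)).
  have [[oN nN] [oN' nN']] := (eP w, e'P w).
  have ex_C : exists C, good w (Rl w) C := refine Minf rA rB sR cR oN nN oN' nN'.
  rewrite CE /step; case: pselect => [H|] //.
  exact: projT2 (cid H).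
exists (\bigcap_(w in [set: W]) P w); split.
- apply: nested_correspondences => [w|u v]; first by case: (goodP w).
  by case: (lt_total u v) => [/PS|->|/PS]; [right|left|left].
- move=> a Pa; apply: contrapT => /open_normal_separation[N [oN nN]]; apply.
  have [w <-] := e_all N oN nN; have [_ _ + _] := goodP w; apply.
  exact: (Pa w).
- move=> b Pb; apply: contrapT => /open_normal_separation[N [oN nN]]; apply.
  have [w <-] := e'_all N oN nN; have [_ _ _] := goodP w; apply.
  exact: (Pb w).
Qed.

(** A correspondence whose fibres over 1 are trivial is the graph of an
    isomorphism, and it is closed, so both directions are continuous. *)
Theorem rich_isomorphic (A B : profiniteGroupType) (M : Type) :
  embeds nat M -> rich A M -> rich B M ->
  embeds {N : set A | open N /\ normal_subgroup N} M ->
  embeds {N : set B | open N /\ normal_subgroup N} M ->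
  exists (f : A -> B) (g : B -> A),
    [/\ continuous_hom f, continuous_hom g, cancel f g & cancel g f].
Proof.
move=> Minf rA rB AM BM.
have [R [cR RA RB]] := back_and_forth Minf rA rB AM BM.
have [cl_R subR sA sB] := cR.
have uniqB a b b' : R (a, b) -> R (a, b') -> b = b'.
  move=> Rb Rb'; have := corrM cR (corrV cR Rb) Rb'.
  by rewrite mulVg => /RB E; rewrite -[LHS]mulg1 -E mulVKg.
have uniqA a a' b : R (a, b) -> R (a', b) -> a = a'.
  move=> Ra Ra'; have := corrM cR (corrV cR Ra) Ra'.
  by rewrite mulVg => /RA E; rewrite -[LHS]mulg1 -E mulVKg.
have [f fP] := choice sA; have [g gP] := choice sB.
have fE a b : f a = b <-> R (a, b) by split=> [<-//|]; apply: uniqB.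
have gE a b : g b = a <-> R (a, b) by split=> [<-//|]; apply: uniqA.
exists f, g; split.
- split.
    split; first by apply/fE; exact: corr1.
    by move=> a a'; apply/fE; apply: corrM.
  apply: closed_graph_continuous;
    [exact: profinite_compact..|exact: profinite_hausdorff|].
  by have -> : [set p | f p.1 = p.2] = R by apply/seteqP; split=> -[a b] /fE.
- split.
    split; first by apply/gE; exact: corr1.
    by move=> a a'; apply/gE; apply: corrM.
  apply: closed_graph_continuous;
    [exact: profinite_compact..|exact: profinite_hausdorff|].
  have -> : [set p | g p.1 = p.2] = [set p : B * A | R (p.2, p.1)].
    by apply/seteqP; split=> -[b a] /gE.
  by have [] := swap_correspondence cR.
- by move=> a; apply/gE.
- by move=> b; apply/fE.
Qed.

(** * The characterization of free profinite groups *)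

Lemma basis_transport (F G : profiniteGroupType) (S : set F) (f : G -> F) (g : F -> G) :
  continuous_hom f -> continuous_hom g -> cancel f g -> cancel g f ->
  generates S -> converges_to_1 S ->
  (forall (D : profiniteGroupType) (phi0 : F -> D), map_converges_to_1 S phi0 ->
    exists phi : F -> D, continuous_hom phi /\ forall s, S s -> phi s = phi0 s) ->
  [/\ generates (g @` S), converges_to_1 (g @` S) &
    forall (D : profiniteGroupType) (phi0 : G -> D), map_converges_to_1 (g @` S) phi0 ->
      exists phi : G -> D, continuous_hom phi /\ forall s, (g @` S) s -> phi s = phi0 s].
Proof.
move=> [fH fc] [gH gc] fK gK genS cS univS; split.
- apply/seteqP; split=> // x _ H [[sH cH] SH].
  have : [set: F] (f x) by [].
  rewrite -genS => /(_ (g @^-1` H)) => Hfx.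
  suff : (g @^-1` H) (f x) by rewrite /= fK.
  apply: Hfx; split; last by move=> s Ss; apply: SH; exists s.
  split; first exact: subgroup_preim.
  by move/continuous_closedP: gc; apply.
- move=> N oN nN.
  have fin : finite_set (S `\` g @^-1` N).
    by apply: cS; [move/continuousP: gc; apply|exact: normal_preim].
  by apply: sub_finite_set (finite_image g fin) => _ [[s Ss <-] nNs]; exists s.
- move=> D phi0 cphi.
  have [|phi [phiH phiS]] := univS D (phi0 \o g).
    move=> N oN nN; apply: sub_finite_set (finite_image f (cphi N oN nN)).
    by move=> s [Ss nNs]; exists (g s); [split=> //; exists s|exact: gK].
  exists (phi \o f); split; first exact: continuous_hom_comp.
  by move=> _ [s Ss <-] /=; rewrite gK phiS.
Qed.

Theorem theorem2p1 (Pi : profiniteGroupType) (M : Type)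
    (M_infinite : infinite_set [set: M]) :
  free_profinite_of_rank Pi M <-> projective Pi /\ quasi_free Pi M.
Proof.
have Minf : embeds nat M by apply/infinite_embeds.
split=> [[[S [genS cS univS]] [[T [genT cT cardT]] minM]]|[projPi qfPi]].
  have MS : embeds M {x | S x} by apply/card_leTl; exact: minM.
  have TM : embeds {x | T x} M.
    by apply/card_leTr; move: cardT; rewrite card_eq_le => /andP[].
  split=> [E finE|E ntE finE _].
    exact: (free_weak_solution genS cS univS finE).
  rewrite card_eq_le; apply/andP; split.
    apply/card_leTr; apply: embeds_trans (embeds_hom Minf genT cT TM finE).
    by apply: embeds_sig => lam [[]].
  by apply/card_leTl; apply: (free_proper_solutions genS cS univS).
have richPi := rich_of_projective_quasi_free projPi qfPi.
pose F : profiniteGroupType := free_group M; pose S : set F := range (@free_gen M).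
have genS : generates S := @free_gen_generates M.
have cS : converges_to_1 S := @free_gen_converges M.
have univS := @free_gen_extension M.
have cardS : S #= [set: M] by apply: card_inj_range; exact: free_gen_inj.
have MS : embeds M {x | S x}.
  by apply/card_leTl; move: cardS; rewrite card_eq_le => /andP[].
have SM : embeds {x | S x} M.
  by apply/card_leTr; move: cardS; rewrite card_eq_le => /andP[].
have richF : rich F M.
  apply: rich_of_proper_solutions => E finE ntE.
  exact: (free_proper_solutions genS cS univS).
have openPi : embeds {N : set Pi | open N /\ normal_subgroup N} M.
  by apply: embeds_open_normal => // gT; apply: quasi_free_embeds_epi.
have openF : embeds {N : set F | open N /\ normal_subgroup N} M.
  apply: embeds_open_normal => // gT.
  apply: embeds_trans (embeds_hom Minf genS cS SM (@disc_finite gT)).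
  by apply: embeds_sig => q [].
have [f [g [fH gH fK gK]]] := rich_isomorphic Minf richPi richF openPi openF.
have [genT cT univT] := basis_transport fH gH fK gK genS cS univS.
split; first by exists (g @` S).
split=> [|U genU cU].
  exists (g @` S); split=> //; apply: card_eq_trans cardS.
  by apply: inj_card_eq => x y _ _; apply: (can_inj gK).
(* U is bounded below by the number of epimorphisms onto 'S_2 *)
have nt2 : exists g : 'S_2, g <> 1.
  by exists (tperm ord0 ord_max) => /permP/(_ ord0); rewrite tpermL perm1.
apply/card_leTl; apply: embeds_generators Minf genU cU (@disc_finite 'S_2) _.
have := quasi_free_card_epi qfPi nt2.
rewrite card_eq_le => /andP[_ /card_leTl Mepi].
by apply: embeds_trans Mepi _; apply: embeds_sig => q [].
Qed.
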